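(* Let $q=p^d$ with $p$ an odd prime and $d\in\mathbb N$, and let $M=(E,r)$ be a regular matroid without coloops. For $\alpha\in(\mathbb F_q^* )^E$ let $A_\perp^*=A_\perp^*(\alpha)$ be any subset $A\subseteq E$ of maximal cardinality such that $s(M.A;\alpha)\neq0$. Then $$\chi_{M^\perp}(q)=\sum_{\alpha\in(\mathbb F_q^* )^E} g\bigl(q,r(M.A_\perp^* )\bigr)\,\eta\bigl(s(M.A_\perp^*;\alpha)\bigr),$$ and each term is independent of the choice of $A_\perp^*$.
   Context: A matroid $M=(E,r)$ has finite ground set $E$ and rank function $r$; it is regular if representable over every field. The dual matroid $M^\perp=(E,r^\perp)$ has $r^\perp(A)=r(E\setminus A)+|A|-r(E)$. An element $e$ is a coloop of $M$ if $r^\perp(\{e\})=0$. For $A\subseteq E$ with $C=E\setminus A$, the contraction $M.A$ is the matroid on $A$ with rank function $r_{M.A}(B)=r(C\cup B)-r(C)$ for $B\subseteq A$; $r(M.A)$ denotes $r_{M.A}(A)=r(E)-r(E\setminus A)$. Bases of a matroid $N$ on ground set $A$ with rank function $r_N$ are sets $B\subseteq A$ with $r_N(B)=|B|=r_N(A)$, and $s(N;\alpha)=\sum_B\prod_{e\in B}\alpha_e$ over all bases (empty product $=1$). $\chi_N(x)=\sum_{A'\subseteq A}(-1)^{|A'|}x^{r_N(A)-r_N(A')}$. $\mathbb F_q^*$ is the set of nonzero elements of $\mathbb F_q$; $\eta$ is the quadratic character of $\mathbb F_q$ ($\eta(0)=0$, $\eta(x)=1$ for nonzero squares, $-1$ for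 non-squares). For $m\in\mathbb N_0$: $g(q,m)=0$ if $m$ is odd; if $m$ is even, $g(q,m)=1/q^{m/2}$ when $q\equiv1\pmod4$ and $g(q,m)=1/(-q)^{m/2}$ when $q\equiv3\pmod4$. *)

(* Defs.v *)
From HB Require Import structures.
From mathcomp Require Export all_boot all_order all_algebra.
From mathcomp Require Import zify.

Set Implicit Arguments.
Unset Strict Implicit.
Unset Printing Implicit Defensive.

Import Order.TTheory GRing.Theory Num.Theory.

(* The ground set is a subset of an ambient finite type, so that a matroid and
   its contractions live over the same type.  The values of [rk] on sets that
   are not included in [ground] are irrelevant. *)
Record matroid (T : finType) := Matroid {
  ground : {set T};
  rk : {set T} -> nat;
  rk_card : forall A : {set T}, A \subset ground -> rk A <= #|A|;
  rk_mono : forall A B : {set T}, A \subset B -> B \subset ground -> rk A <= rk B;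
  rk_submod : forall A B : {set T}, A \subset ground -> B \subset ground ->
    rk (A :|: B) + rk (A :&: B) <= rk A + rk B
}.

Lemma setDU_sub (T : finType) (A B : {set T}) :
  A \subset B -> B :\: A :|: A = B.
Proof. by move=> AB; rewrite setUC -{1}(setIidPr AB) setID. Qed.

Section MatroidOps.
Variables (T : finType) (M : matroid T).
Local Notation E := (ground M).
Local Notation r := (rk M).

Lemma rk_setU_leq (A B : {set T}) :
  A \subset E -> B \subset E -> r (A :|: B) <= r A + #|B|.
Proof.
move=> AE BE; have := rk_submod AE BE; have := rk_card BE; lia.
Qed.

(* The subtraction never truncates on subsets of the ground set. *)
Definition dual_rk (A : {set T}) : nat := r (E :\: A) + #|A| - r E.

Lemma dual_rk_ge (A : {set T}) : A \subset E -> r E <= r (E :\: A) + #|A|.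
Proof.
move=> AE; have := rk_setU_leq (subsetDl E A) AE.
by rewrite setDU_sub //.
Qed.

Lemma dual_rk_card (A : {set T}) : A \subset E -> dual_rk A <= #|A|.
Proof.
move=> AE; have := rk_mono (subsetDl E A) (subxx E); rewrite /dual_rk; lia.
Qed.

Lemma dual_rk_mono (A B : {set T}) :
  A \subset B -> B \subset E -> dual_rk A <= dual_rk B.
Proof.
move=> AB BE; rewrite /dual_rk leq_sub2r //.
have BAE : B :\: A \subset E by apply: subset_trans BE; apply: subsetDl.
have := rk_setU_leq (subsetDl E B) BAE.
have -> : (E :\: B) :|: (B :\: A) = E :\: A.
  apply/setP=> x; rewrite !inE.
  have := subsetP AB x; have := subsetP BE x.
  by case: (x \in A); case: (x \in B); case: (x \in E) => //= h1 h2;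
     (have := h1 isT) || (have := h2 isT).
have := cardsD B A; rewrite (setIidPr AB); have := subset_leq_card AB; lia.
Qed.

Lemma dual_rk_submod (A B : {set T}) : A \subset E -> B \subset E ->
  dual_rk (A :|: B) + dual_rk (A :&: B) <= dual_rk A + dual_rk B.
Proof.
move=> AE BE.
have ABE : A :|: B \subset E by rewrite subUset AE.
have AIE : A :&: B \subset E by apply: subset_trans AE; apply: subsetIl.
have := rk_submod (subsetDl E A) (subsetDl E B).
rewrite -setDIr -setDUr.
have := cardsUI A B.
move: (dual_rk_ge AE) (dual_rk_ge BE) (dual_rk_ge ABE) (dual_rk_ge AIE).
rewrite /dual_rk; lia.
Qed.

Definition dual : matroid T := Matroid dual_rk_card dual_rk_mono dual_rk_submod.

Definition contr_rk (A B : {set T}) : nat := r ((E :\: A) :|: B) - r (E :\: A).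

Section Contraction.
Variable A : {set T}.

Lemma contr_subE (B : {set T}) : B \subset E :&: A -> (E :\: A) :|: B \subset E.
Proof. by rewrite subsetI subUset subsetDl => /andP[]. Qed.

Lemma contr_rk_card (B : {set T}) :
  B \subset E :&: A -> contr_rk A B <= #|B|.
Proof.
move=> BA; have BE : B \subset E by apply: subset_trans BA (subsetIl _ _).
have := rk_setU_leq (subsetDl E A) BE; rewrite /contr_rk; lia.
Qed.

Lemma contr_rk_mono (B C : {set T}) :
  B \subset C -> C \subset E :&: A -> contr_rk A B <= contr_rk A C.
Proof.
by move=> BC CA; rewrite leq_sub2r // rk_mono ?contr_subE // setUS.
Qed.

Lemma contr_rk_submod (B C : {set T}) :
  B \subset E :&: A -> C \subset E :&: A ->
  contr_rk A (B :|: C) + contr_rk A (B :&: C) <= contr_rk A B + contr_rk A C.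
Proof.
move=> BA CA; have := rk_submod (contr_subE BA) (contr_subE CA).
rewrite -setUUr -setUIr.
have le (D : {set T}) : D \subset E :&: A -> r (E :\: A) <= r ((E :\: A) :|: D).
  by move=> DA; rewrite rk_mono ?contr_subE ?subsetUl.
have BCA : B :|: C \subset E :&: A by rewrite subUset BA.
have BIA : B :&: C \subset E :&: A by apply: subset_trans BA; apply: subsetIl.
move: (le _ BA) (le _ CA) (le _ BCA) (le _ BIA); rewrite /contr_rk; lia.
Qed.

(* M.A; it is only meant for A \subset E, where the ground set E :&: A is A. *)
Definition contraction : matroid T :=
  Matroid contr_rk_card contr_rk_mono contr_rk_submod.

End Contraction.

Definition coloop (e : T) : Prop := e \in E /\ rk dual [set e] = 0%N.

Definition basis (B : {set T}) : bool :=
  [&& B \subset E, r B == #|B| & #|B| == r E].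

Definition total_rk : nat := r E.

End MatroidOps.

Local Open Scope ring_scope.

Definition representable (F : fieldType) (T : finType) (M : matroid T) : Prop :=
  exists (n : nat) (v : T -> 'rV[F]_n),
    forall A : {set T}, A \subset ground M ->
      rk M A = \rank (\sum_(e in A) <<v e>>)%MS.

Definition regular (T : finType) (M : matroid T) : Prop :=
  forall F : fieldType, representable F M.

Definition basis_sum (F : fieldType) (T : finType) (N : matroid T)
    (alpha : T -> F) : F :=
  \sum_(B : {set T} | basis N B) \prod_(e in B) alpha e.

Definition charpoly (T : finType) (N : matroid T) : {poly rat} :=
  \sum_(A : {set T} | A \subset ground N)
    (-1) ^+ #|A| *: 'X^(rk N (ground N) - rk N A).

Definition eta (F : finFieldType) (x : F) : rat :=
  if x == 0 then 0 else if [exists y : F, x == y ^+ 2] then 1 else -1.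

(* Only used for odd q, so the last branch is q = 3 mod 4. *)
Definition g (q m : nat) : rat :=
  if odd m then 0
  else if (q %% 4 == 1)%N then 1 / q%:R ^+ m./2
  else 1 / (- q%:R) ^+ m./2.

(* (F^* )^E, each function on E being extended by 0 to the ambient type. *)
Definition nzfun (F : finFieldType) (T : finType) (E : {set T}) :
    {set {ffun T -> F}} :=
  [set alpha in pffun_on 0 (mem E) (predC1 0)].

Definition is_Aperp (F : fieldType) (T : finType) (M : matroid T)
    (alpha : T -> F) (A : {set T}) : Prop :=
  [/\ A \subset ground M,
      basis_sum (contraction M A) alpha != 0
    & forall B : {set T}, B \subset ground M ->
        basis_sum (contraction M B) alpha != 0 -> (#|B| <= #|A|)%N].

Lemma contraction_ground (T : finType) (M : matroid T) (A : {set T}) :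
  A \subset ground M -> ground (contraction M A) = A.
Proof. by move=> AE; apply/setIidPr. Qed.

Lemma total_rk_contraction (T : finType) (M : matroid T) (A : {set T}) :
  A \subset ground M ->
  total_rk (contraction M A) = (rk M (ground M) - rk M (ground M :\: A))%N.
Proof.
move=> AE; rewrite /total_rk /= /contr_rk (setIidPr AE).
by rewrite setDU_sub //.
Qed.

Lemma nzfunP (F : finFieldType) (T : finType) (E : {set T})
    (alpha : {ffun T -> F}) :
  reflect (forall e, (alpha e != 0) = (e \in E)) (alpha \in nzfun F E).
Proof.
rewrite inE; apply: (iffP pfamilyP) => [[/subsetP sE nz] e|h].
  by apply/idP/idP => [/sE //|/nz].
by split=> [|e eE]; [apply/subsetP=> e; rewrite inE h | rewrite inE h].
Qed.

Lemma Aperp_exists (F : fieldType) (T : finType) (M : matroid T)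
    (alpha : T -> F) : exists A, is_Aperp M alpha A.
Proof.
pose P (A : {set T}) :=
  (A \subset ground M) && (basis_sum (contraction M A) alpha != 0).
have P0 : P set0.
  rewrite /P sub0set /basis_sum (bigD1 set0) /=; last first.
    by rewrite /basis /= setI0 subxx /contr_rk setU0 subnn cards0.
  rewrite big_set0 big1 ?addr0 ?oner_eq0 // => B /andP[/andP[sB _]].
  by rewrite -subset0; move: sB; rewrite /= setI0 => ->.
case: (arg_maxnP (fun A : {set T} => #|A|) P0) => A /andP[AE nz] max.
exists A; split=> // B BE nzB; apply: max.
by rewrite /P BE.
Qed.

(* Main.v *)
Require Import Defs.
From mathcomp Require Import all_boot all_order all_algebra.
From mathcomp Require Import all_fingroup all_solvable all_field mxabelem.
From mathcomp Require Import zify ring.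

(** A regular matroid has a representation v over F all of whose frame
    determinants are +1 or -1: being binary as well, every 2x2 block without
    zeros is singular in coordinates with respect to any basis, so pivoting
    creates no new entries, and a suitable rescaling of the vectors makes all
    coordinates 0, 1 or -1. By the Cauchy-Binet formula, s(M.A; alpha) is then,
    up to a nonzero square, the determinant of the form
    Q_alpha(y) = sum_e alpha_e <y, v_e>^2 restricted to the common zeros of the
    v_e, e \notin A. If A is as large as possible, these zeros are a complement
    of the radical of Q_alpha, so the rank of M.A and eta (s(M.A; alpha)) are the
    rank and the discriminant of Q_alpha.

    The number N of zeros of a quadratic form of rank m and discriminant D in n
    variables satisfies q N - q^n = (q - 1) q^n g(q, m) eta(D). Summed over alpha,
    the left side can be computed in a second way: for fixed y the substitution
    x_e = alpha_e <y, v_e> (x_e = alpha_e when <y, v_e> = 0) makes Q_alpha(y)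
    linear in y, so that only the x with sum_e x_e v_e = 0 contribute. These are the nowhere-zero
    flows, which inclusion-exclusion counts by the characteristic polynomial of
    the dual. *)

Set Implicit Arguments.
Unset Strict Implicit.
Unset Printing Implicit Defensive.

Import GRing.Theory.
Local Open Scope ring_scope.

(** * Frames and pivots *)

Definition rows_of (F : fieldType) (T : Type) (n m : nat) (v : T -> 'rV[F]_n)
  (f : 'I_m -> T) : 'M[F]_(m, n) := \matrix_i v (f i).

Definition update (T : Type) (n : nat) (f : 'I_n -> T) (i : 'I_n) (x : T) :=
  fun j => if j == i then x else f j.

(** Meaningful only when [f] is a frame: [invmx] returns a singular matrix unchanged. *)
Definition coords (F : fieldType) (T : Type) (n : nat) (v : T -> 'rV[F]_n)
  (f : 'I_n -> T) (x : T) : 'rV[F]_n := v x *m invmx (rows_of v f).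

Definition frame (F : fieldType) (T : Type) (n : nat) (v : T -> 'rV[F]_n)
  (f : 'I_n -> T) : bool := rows_of v f \in unitmx.

Section Coordinates.
Variables (F : fieldType) (T : Type) (n : nat) (v : T -> 'rV[F]_n).
Implicit Types (f : 'I_n -> T) (i j : 'I_n) (x z : T).

Lemma frame_det f : frame v f = (\det (rows_of v f) != 0).
Proof. by rewrite /frame unitmxE unitfE. Qed.

Lemma coordsK f x : frame v f -> coords v f x *m rows_of v f = v x.
Proof. by move=> fr; rewrite mulmxKV. Qed.

Lemma coords_unique f x u : frame v f -> u *m rows_of v f = v x -> coords v f x = u.
Proof. by move=> fr E; rewrite /coords -E mulmxK. Qed.

Lemma coords_frame f j : frame v f -> coords v f (f j) = delta_mx 0 j.
Proof.
move=> fr; apply: coords_unique => //; rewrite -rowE.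
by apply/rowP=> k; rewrite !mxE.
Qed.

Lemma rows_of_coords m f (h : 'I_m -> T) :
  frame v f -> rows_of v h = rows_of (coords v f) h *m rows_of v f.
Proof.
move=> fr; apply/row_matrixP => k; rewrite row_mul !rowK.
by rewrite coordsK.
Qed.

(** Cramer's rule: in the coordinates of [f], the updated matrix is the identity with row [i]
    replaced, so its determinant is the diagonal entry of that row. *)
Lemma det_update f i x : frame v f ->
  \det (rows_of v (update f i x)) = coords v f x 0 i * \det (rows_of v f).
Proof.
move=> fr; rewrite (rows_of_coords _ fr) det_mulmx; congr (_ * _).
have rE j : row j (rows_of (coords v f) (update f i x)) =
    if j == i then coords v f x else delta_mx 0 j.
  by rewrite rowK /update; case: eqP => // _; rewrite coords_frame.
have E j k : rows_of (coords v f) (update f i x) j k =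
    if j == i then coords v f x 0 k else (k == j)%:R.
  have /rowP/(_ k) := rE j; rewrite mxE => ->.
  by case: ifP => // _; rewrite mxE eqxx.
rewrite (expand_det_col _ i) (bigD1 i) //= big1 ?addr0.
  rewrite E eqxx /cofactor -signr_odd addnn odd_double expr0 mul1r.
  have -> : row' i (col' i (rows_of (coords v f) (update f i x))) = 1%:M.
    apply/matrixP=> a b.
    rewrite mxE [X in X = _]mxE E [X in if X then _ else _]eq_sym (negPf (neq_lift _ _)) mxE.
    by rewrite (inj_eq lift_inj) eq_sym.
  by rewrite det1 mulr1.
by move=> j ne; rewrite E (negPf ne) eq_sym (negPf ne) mul0r.
Qed.

Lemma frame_update f i x : frame v f ->
  frame v (update f i x) = (coords v f x 0 i != 0).
Proof.
by move=> fr; move: (fr); rewrite !frame_det det_update // mulf_eq0 negb_or => ->; rewrite andbT.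
Qed.

(** Exchange formula: the expansion of [v x] is solved for [v (f i)], which is then eliminated from
    the expansion of [v z]. *)
Lemma coords_update f i x z j : frame v f -> coords v f x 0 i != 0 ->
  coords v (update f i x) z 0 j =
  if j == i then coords v f z 0 i / coords v f x 0 i
  else coords v f z 0 j - coords v f z 0 i * coords v f x 0 j / coords v f x 0 i.
Proof.
move=> fr nz.
pose u : 'rV[F]_n := \row_j (if j == i then coords v f z 0 i / coords v f x 0 i
  else coords v f z 0 j - coords v f z 0 i * coords v f x 0 j / coords v f x 0 i).
rewrite (_ : coords v (update f i x) z = u); first by rewrite mxE.
apply: coords_unique; first by rewrite frame_update.
rewrite (rows_of_coords _ fr) mulmxA -[RHS](coordsK _ fr); congr (_ *m _).
have uE l : u 0 l = if l == i then coords v f z 0 i / coords v f x 0 i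
  else coords v f z 0 l - coords v f z 0 i * coords v f x 0 l / coords v f x 0 i by rewrite mxE.
apply/rowP=> k; rewrite mxE (bigD1 i) //= uE eqxx.
have -> : rows_of (coords v f) (update f i x) i k = coords v f x 0 k.
  by rewrite mxE /update eqxx.
have E l : l != i -> rows_of (coords v f) (update f i x) l k = (k == l)%:R.
  by move=> ne; rewrite mxE /update (negPf ne) coords_frame // mxE eqxx.
have [ki|ne] := eqVneq k i.
  rewrite big1 ?addr0; first by rewrite ki divfK.
  by move=> l ne; rewrite E // ki eq_sym (negPf ne) mulr0.
rewrite (bigD1 k) //= big1 ?addr0.
  by rewrite E // eqxx mulr1 uE (negPf ne) mulrAC addrC subrK.
by move=> l /andP[li lk]; rewrite E // eq_sym (negPf lk) mulr0.
Qed.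

End Coordinates.

(** * Unimodularity and pivots *)

Definition unimod (F : fieldType) (T : finType) (n : nat) (v : T -> 'rV[F]_n)
    (S : {set T}) (f : 'I_n -> T) : Prop :=
  forall x j, x \in S -> coords v f x 0 j != 0 -> coords v f x 0 j ^+ 2 = 1.

(** The connected components of this graph are the blocks of coordinates that will be rescaled by a
    common factor. *)
Definition adjacent (F : fieldType) (T : finType) (n : nat) (v : T -> 'rV[F]_n)
    (S : {set T}) (f : 'I_n -> T) : rel 'I_n :=
  fun i j => [exists x in S, (coords v f x 0 i != 0) && (coords v f x 0 j != 0)].

Section Binary.
Variables (F K : fieldType) (T : finType) (n : nat).
Variables (v : T -> 'rV[F]_n) (w : T -> 'rV[K]_n).
Hypothesis K2 : forall a : K, a != 0 -> a = 1.
Hypothesis same_frames : forall f, frame v f = frame w f.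
Implicit Types (f : 'I_n -> T) (i j : 'I_n) (x z : T) (S : {set T}).

(** A coordinate is nonzero exactly when the corresponding exchange gives a frame, and both
    representations have the same frames. *)
Lemma same_support f x i : frame v f ->
  (coords v f x 0 i != 0) = (coords w f x 0 i != 0).
Proof. by move=> fr; rewrite -!frame_update -?same_frames. Qed.

(* A 2x2 submatrix without zeros has determinant 0 over the two-element field,
   hence over every field representing the same matroid. *)
Lemma two_by_two f x z i j : frame v f -> i != j ->
  coords v f x 0 i != 0 -> coords v f x 0 j != 0 ->
  coords v f z 0 i != 0 -> coords v f z 0 j != 0 ->
  coords v f z 0 j = coords v f z 0 i * coords v f x 0 j / coords v f x 0 i.
Proof.
move=> fr ne xi xj zi zj.
(* In the pivoted frame, coordinate [j] of [z] is the 2x2 determinant divided by [coords v f x 0 i].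
   Over [K] all entries are 1, so it vanishes there, hence also over [F]. *)
have fr1 : frame v (update f i x) by rewrite frame_update.
have := same_support z j fr1.
rewrite (coords_update _ _ fr xi) (coords_update _ _ _ _) -?same_frames //.
  rewrite [j == i]eq_sym (negPf ne).
  do 4! (rewrite [coords w _ _ _ _]K2; last by rewrite -same_support //).
  by rewrite mulr1 divr1 subrr eqxx => /negbFE; rewrite subr_eq0 => /eqP.
by rewrite -same_support.
Qed.

(** Up to sign, the new entries are old ones or their products and quotients, except where [z] and
    [x] both have nonzero coordinates [i] and [j]; there [two_by_two] makes the new entry 0. *)
Lemma unimod_update f S x i : frame v f -> unimod v S f -> x \in S ->
  coords v f x 0 i != 0 -> unimod v S (update f i x).
Proof.
move=> fr u xS xi z j zS; rewrite coords_update //.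
have sq y k : y \in S -> coords v f y 0 k != 0 -> coords v f y 0 k ^+ 2 = 1 by exact: u.
have [_|ji] := eqVneq j i.
  rewrite mulf_eq0 negb_or => /andP[zi _].
  by rewrite exprMn exprVn !sq // invr1 mulr1.
have [->|zi] := eqVneq (coords v f z 0 i) 0.
  by rewrite !mul0r subr0; apply: sq.
have [->|xj] := eqVneq (coords v f x 0 j) 0.
  by rewrite mulr0 mul0r subr0; apply: sq.
have [->|zj] := eqVneq (coords v f z 0 j) 0.
  by rewrite sub0r sqrrN !exprMn exprVn !sq // invr1 !mulr1.
by rewrite (two_by_two fr _ xi xj zi zj) ?subrr ?eqxx // eq_sym.
Qed.

(** Induction on the length of the path, for all frames at once. Either [z] or the first linking
    element [x] allows a shortcut by [two_by_two], or a pivot on [x] moves the coordinate of [z]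
    from [i] to [j], up to sign, and removes the first step. *)
Lemma balanced_path S z f i p : frame v f -> unimod v S f ->
  path (adjacent v S f) i p ->
  coords v f z 0 i != 0 -> coords v f z 0 (last i p) != 0 ->
  coords v f z 0 i ^+ 2 = coords v f z 0 (last i p) ^+ 2.
Proof.
have [m le] := ubnP (size p); elim: m => // m IHm in f i p le *.
move=> fr u; case: p le => // j p /= le /andP[/existsP[x /and3P[xS xi xj]] pth] zi zl.
have adj k : coords v f x 0 k != 0 -> coords v f z 0 k != 0 ->
    coords v f z 0 i ^+ 2 = coords v f z 0 k ^+ 2.
  move=> xk zk; have [-> //|ik] := eqVneq i k.
  rewrite (two_by_two fr ik xi xk zi zk) !exprMn exprVn.
  by rewrite !(u x _ xS) // invr1 !mulr1.
have [zj|zj] := boolP (coords v f z 0 j == 0); last first.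
  by rewrite (adj j) //; apply: IHm => //.
have [xl|xl] := boolP (coords v f x 0 (last j p) == 0); last exact: adj.
set f1 := update f i x.
have fr1 : frame v f1 by rewrite frame_update.
have ne k : coords v f x 0 k == 0 -> k != i by apply: contraTneq => ->.
(* The rest of the path survives the pivot unless one of its links [y] has a nonzero coordinate [i];
   such a [y] gives a shorter path from [i] to the same end. *)
have [pth1|[p2 [sz pth2 last2]]] : path (adjacent v S f1) j p \/
    exists p2, [/\ (size p2 <= size p)%N, path (adjacent v S f) i p2
      & last i p2 = last j p].
- elim: p j {le zl zj xj xl} pth => [|k p IHp] j /=; first by left.
  case/andP=> /existsP[y /and3P[yS yj yk]] pth.
  have [yi|yi] := boolP (coords v f y 0 i == 0); last first.
    right; exists (k :: p); split=> //=; rewrite pth andbT.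
    by apply/existsP; exists y; rewrite yS yi.
  case: (IHp k pth) => [pth1|[p2 [sz pth2 last2]]]; last first.
    by right; exists p2; split=> //; apply: leq_trans sz _.
  left; rewrite pth1 andbT; apply/existsP; exists y; rewrite yS /=.
  have same l : coords v f y 0 l != 0 -> coords v f1 y 0 l != 0.
    move=> yl; rewrite coords_update // (eqP yi) !mul0r subr0 ifN //.
    by apply: contraNneq yl => ->.
  by rewrite !same.
- have ji : j != i by apply: contraNneq zi => <-.
  have E1 : coords v f1 z 0 j ^+ 2 = coords v f z 0 i ^+ 2.
    rewrite coords_update // (negPf ji) (eqP zj) sub0r sqrrN !exprMn exprVn.
    by rewrite !(u x _ xS) // invr1 !mulr1.
  have E2 : coords v f1 z 0 (last j p) = coords v f z 0 (last j p).
    by rewrite coords_update // (negPf (ne _ xl)) (eqP xl) mulr0 mul0r subr0.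
  rewrite -E1 -E2; apply: IHm => //.
  + exact: unimod_update.
  + by rewrite -sqrf_eq0 E1 sqrf_eq0.
  + by rewrite E2.
- by rewrite -last2; apply: IHm => //; [apply: leq_ltn_trans sz _ | rewrite last2].
Qed.

(* Walk from f to h one element at a time; unimodularity survives each pivot. *)
Lemma unimod_det f h : frame v f -> unimod v setT f -> frame v h ->
  \det (rows_of v h) ^+ 2 = \det (rows_of v f) ^+ 2.
Proof.
have [m le] := ubnP #|[set i | f i != h i]|.
elim: m => // m IHm in f h le *; move=> fr u frh.
have [k ne|eq] := pickP (fun i => f i != h i); last first.
  congr (\det _ ^+ 2); apply/matrixP=> i j; rewrite !mxE.
  by have /negbFE/eqP -> := eq i.
(* Otherwise column [k] of the coordinates of [h] is zero and [h] is not a frame. *)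
have [i nzi|z] := pickP (fun i => coords v f (h i) 0 k != 0); last first.
  have nzd : \det (rows_of (coords v f) h) != 0.
    have := frh; rewrite frame_det (rows_of_coords _ fr) det_mulmx mulf_eq0.
    by rewrite negb_or => /andP[].
  suff d0 : \det (rows_of (coords v f) h) = 0 by rewrite d0 eqxx in nzd.
  rewrite (expand_det_col _ k) big1 // => i _.
  by rewrite mxE; have /negbFE/eqP -> := z i; rewrite mul0r.
have fhi : f i != h i.
  apply: contraNneq nzi => fh; rewrite -fh coords_frame // mxE eqxx /=.
  by have [ki|//] := eqVneq k i; rewrite ki fh eqxx in ne.
(* Position [i] was a mismatch already, so swapping [i] and [k] in [h] makes no new one. It brings
   [h i] to position [k], where the pivot puts it, and changes at most the sign of the
   determinant. *)
pose h1 j := h (tperm i k j).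
have Eh : \det (rows_of v h1) ^+ 2 = \det (rows_of v h) ^+ 2.
  have -> : rows_of v h1 = row_perm (tperm i k) (rows_of v h).
    by apply/matrixP=> a b; rewrite !mxE.
  by rewrite row_permE det_mulmx det_perm exprMn sqrr_sign mul1r.
have fr1 : frame v (update f k (h i)) by rewrite frame_update.
rewrite -Eh (IHm (update f k (h i)) h1) //.
- by rewrite det_update // exprMn (u (h i)) // mul1r.
- apply: leq_trans (_ : #|[set i | f i != h i] :\ k| < m)%N; last first.
    by move: le; rewrite (cardsD1 k) inE ne add1n ltnS.
  rewrite ltnS subset_leq_card //; apply/subsetP=> j; rewrite !inE /update /h1.
  have [->|jk] /= := eqVneq j k; first by rewrite tpermR eqxx.
  have [->|ji] := eqVneq j i; first by [].
  by rewrite tpermD // eq_sym.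
- exact: unimod_update.
- by rewrite frame_det -sqrf_eq0 Eh sqrf_eq0 -frame_det.
Qed.

End Binary.

(** * Unimodular representations of regular matroids *)

Section Scaling.
Variables (F : fieldType) (T : finType) (n : nat) (v : T -> 'rV[F]_n) (t : T -> F).
Hypothesis t_neq0 : forall x, t x != 0.

Lemma rows_of_scale f :
  rows_of (fun x => t x *: v x) f = diag_mx (\row_i t (f i)) *m rows_of v f :> 'M_n.
Proof. by apply/matrixP=> i j; rewrite mul_diag_mx !mxE. Qed.

Lemma frame_scale (f : 'I_n -> T) : frame (fun x => t x *: v x) f = frame v f.
Proof.
rewrite !frame_det rows_of_scale det_mulmx det_diag mulf_eq0 negb_or.
rewrite (_ : \prod_i _ != 0) //; apply/prodf_neq0 => i _; by rewrite mxE.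
Qed.

Lemma coords_scale (f : 'I_n -> T) x j : frame v f ->
  coords (fun x => t x *: v x) f x 0 j = t x * coords v f x 0 j / t (f j).
Proof.
move=> fr; pose u : 'rV_n := \row_j (t x * coords v f x 0 j / t (f j)).
rewrite (_ : coords _ f x = u); first by rewrite mxE.
apply: coords_unique; first by rewrite frame_scale.
rewrite rows_of_scale mulmxA -[v x](coordsK x fr) scalemxAl; congr (_ *m _).
apply/rowP=> k; rewrite mul_mx_diag mxE [RHS]mxE.
have -> : u 0 k = t x * coords v f x 0 k / t (f k) by rewrite mxE.
have -> : (\row_i t (f i)) 0 k = t (f k) by rewrite mxE.
by rewrite divfK.
Qed.

End Scaling.

Section UnimodularScaling.
Variables (F K : fieldType) (T : finType) (n : nat).
Hypothesis K2 : forall a : K, a != 0 -> a = 1.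
Variables (w : T -> 'rV[K]_n) (f : 'I_n -> T).

(* Rows of a component meeting the support of z are all rescaled by one coordinate
   of z; by [balanced_path] the choice does not matter up to sign. *)
Lemma unimod_extend (v : T -> 'rV[F]_n) (S : {set T}) (z : T) :
  (forall h, frame v h = frame w h) -> frame v f -> unimod v S f ->
  exists2 t : T -> F, (forall x, t x != 0)
    & unimod (fun x => t x *: v x) (z |: S) f.
Proof.
move=> same fr u.
have [/imageP[j0 _ zE]|zf] := boolP (z \in image f 'I_n).
  exists (fun=> 1) => [x|x j]; first exact: oner_neq0.
  rewrite coords_scale // => [|_]; last exact: oner_neq0.
  rewrite mul1r divr1 !inE => /orP[/eqP->|]; last exact: u.
  rewrite zE coords_frame // mxE; case: (_ && _); last by rewrite eqxx.
  by rewrite expr1n.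
pose e := adjacent v S f.
have symC : connect_sym e.
  apply: sym_connect_sym => i j; apply/existsP/existsP => -[x];
  by case/and3P=> ? ? ?; exists x; apply/and3P.
(* Common factor of the component of [i]: a nonzero coordinate of [z] in it, or 1 if there is
   none. *)
pose h i := if [pick j | connect e i j && (coords v f z 0 j != 0)] is Some j
  then coords v f z 0 j else 1.
have h0 i : h i != 0.
  by rewrite /h; case: pickP => [j /andP[]|]; rewrite ?oner_neq0.
have hE i j : connect e i j -> h i = h j.
  move=> ij; rewrite /h; congr (if _ is Some j then _ else _); apply: eq_pick => k.
  by rewrite (same_connect symC ij).
(* [z] is kept; any other element receives the factor of a component met by its support. Coordinates
   of the elements of [S] other than [z] then stay the same, while coordinate [j] of [z] is divided
   by [h j]. *)
pose t x := if x == z then 1 else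
  if [pick j | coords v f x 0 j != 0] is Some j then h j else 1.
have t0 x : t x != 0.
  by rewrite /t; case: ifP; rewrite ?oner_neq0 //; case: pickP; rewrite ?oner_neq0.
have tf j : t (f j) = h j.
  rewrite /t ifN; last by apply: contraNneq zf => <-; apply: image_f.
  case: pickP => [k|/(_ j)].
    rewrite coords_frame // mxE eqxx /=; case: (k =P j) => [-> //|_].
    by rewrite eqxx.
  by rewrite coords_frame // mxE !eqxx /= oner_eq0.
exists t => // x j xS; rewrite coords_scale // tf.
rewrite !mulf_eq0 !negb_or => /andP[/andP[_ xj] _].
rewrite !exprMn exprVn.
have [xz|xz] := eqVneq x z.
  rewrite xz in xj *; rewrite {1}/t eqxx expr1n mul1r /h.
  case: pickP => [k /andP[/connectP[p pth ->] zk]|/(_ j)].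
    by rewrite -(balanced_path K2 same fr u pth xj zk) mulfV // sqrf_eq0.
  by rewrite connect0 xj.
have {}xS : x \in S by move: xS; rewrite !inE (negPf xz).
rewrite (u x) // mulr1 /t (negPf xz); case: pickP => [k xk|/(_ j)]; last by rewrite xj.
rewrite (hE k j) ?mulfV ?sqrf_eq0 //; apply: connect1.
by apply/existsP; exists x; rewrite xS xk.
Qed.

Lemma unimod_scaling (v : T -> 'rV[F]_n) :
  (forall h, frame v h = frame w h) -> frame v f ->
  exists2 t : T -> F, (forall x, t x != 0) & unimod (fun x => t x *: v x) setT f.
Proof.
move=> same fr.
suff [t t0 u] : exists2 t : T -> F, (forall x, t x != 0)
    & unimod (fun x => t x *: v x) [set x in enum T] f.
  by exists t => // x j _; apply: u; rewrite inE mem_enum.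
elim: (enum T) => [|z s [t t0 u]].
  by exists (fun=> 1) => [x|x j]; rewrite ?oner_neq0 // inE.
case: (@unimod_extend _ _ z _ _ u) => [h||t' t'0 u'].
- by rewrite frame_scale.
- by rewrite frame_scale.
exists (fun x => t' x * t x) => [x|x j]; first by rewrite mulf_neq0.
rewrite set_cons => xS; have := u' x j xS.
have fr1 : frame (fun x => t x *: v x) f by rewrite frame_scale.
rewrite !(coords_scale t'0) // !(coords_scale t0) // coords_scale //; last first.
  by move=> y; rewrite mulf_neq0.
set a := t' x * _ / _; set b := (X in _ -> X != 0 -> _).
suff -> : a = b by [].
by rewrite /a /b !mulrA [t' (f j) * _]mulrC invfM !mulrA.
Qed.

(** Passing to coordinates relative to the rescaled frame [f] gives that frame determinant 1; by
    [unimod_det] all other frames follow up to sign. *)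
Lemma unimodular_frames (v : T -> 'rV[F]_n) :
  (forall h, frame v h = frame w h) -> frame v f ->
  exists t : T -> F, exists N : 'M[F]_n, [/\ forall x, t x != 0, N \in unitmx
    & forall h, frame v h ->
      \det (rows_of (fun x => t x *: v x *m N) h) ^+ 2 = 1].
Proof.
move=> same fr; have [t t0 u] := unimod_scaling same fr.
pose v' x := t x *: v x.
have fr' : frame v' f by rewrite frame_scale.
exists t, (invmx (rows_of v' f)); split=> // [|h frh]; first by rewrite unitmx_inv.
have -> : rows_of (fun x => t x *: v x *m invmx (rows_of v' f)) h
          = rows_of v' h *m invmx (rows_of v' f).
  by apply/row_matrixP=> i; rewrite row_mul !rowK.
rewrite det_mulmx det_inv exprMn exprVn.
have same' k : frame v' k = frame w k by rewrite frame_scale.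
rewrite (unimod_det K2 same' fr' u); first by rewrite mulfV // sqrf_eq0 -frame_det.
by rewrite frame_scale.
Qed.

End UnimodularScaling.

(** * Spans of families of vectors *)

Section Spans.
Variables (F : fieldType) (T : finType).

Lemma sub_spanP m n (v : T -> 'rV[F]_n) (A : {set T}) (B : 'M_(m, n)) :
  reflect (forall e, e \in A -> (v e <= B)%MS) (\sum_(e in A) <<v e>> <= B)%MS.
Proof.
by apply: (iffP sumsmx_subP) => H e eA; have := H e eA; rewrite genmxE.
Qed.

Lemma sub_span n (v : T -> 'rV[F]_n) (A : {set T}) e :
  e \in A -> (v e <= \sum_(e in A) <<v e>>)%MS.
Proof. by move=> eA; rewrite (sumsmx_sup e) // genmxE. Qed.

Lemma eqmx_rows_of m n (v : T -> 'rV[F]_n) (f : 'I_m -> T) :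
  (rows_of v f :=: \sum_(e in f @: setT) <<v e>>)%MS.
Proof.
apply/eqmxP/andP; split.
  by apply/row_subP=> i; rewrite rowK sub_span // imset_f.
apply/sub_spanP=> _ /imsetP[i _ ->]; rewrite -(rowK (fun i => v (f i))).
exact: row_sub.
Qed.

Lemma span_basis n (v : T -> 'rV[F]_n) (A : {set T}) :
  exists k (J : 'I_k -> T), [/\ k = \rank (\sum_(e in A) <<v e>>)%MS,
    forall i, J i \in A, row_free (rows_of v J)
    & (rows_of v J :=: \sum_(e in A) <<v e>>)%MS].
Proof.
pose g0 (i : 'I_#|A|) := enum_val i.
have im : g0 @: setT = A.
  apply/setP=> e; apply/imsetP/idP => [[i _ ->]|eA]; first exact: enum_valP.
  by exists (enum_rank_in eA e); rewrite // /g0 enum_rankK_in.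
have := eqmx_rows_of v g0; rewrite im => E.
pose X := rows_of v g0.
exists (\rank X), (fun i => g0 (maxrankfun X i)).
have -> : rows_of v (fun i => g0 (maxrankfun X i)) = rowsub (maxrankfun X) X.
  by apply/matrixP=> i j; rewrite !mxE.
split; first by rewrite E.
- by move=> i; apply: enum_valP.
- exact: maxrowsub_free.
- by apply: eqmx_trans E; apply: eq_maxrowsub.
Qed.

Lemma span_scale n (v : T -> 'rV[F]_n) (t : T -> F) (A : {set T}) :
  (forall x, t x != 0) ->
  (\sum_(e in A) <<t e *: v e>> = \sum_(e in A) <<v e>>)%MS.
Proof.
by move=> t0; apply: eq_bigr => e _; apply/eq_genmx/eqmx_scale.
Qed.

Lemma rank_span_mulr m n (v : T -> 'rV[F]_n) (B : 'M_(n, m)) (A : {set T}) :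
  row_free B -> \rank (\sum_(e in A) <<v e *m B>>)%MS = \rank (\sum_(e in A) <<v e>>)%MS.
Proof.
move=> fB; rewrite -[RHS](mxrankMfree _ fB) sumsmxMr_gen.
by congr (\rank _); apply: eq_bigr => e _; apply/eq_genmx/eqmxMr/eqmx_sym/genmxE.
Qed.

End Spans.

(** * Representations of [M] in dimension [r] *)

Section Regular.
Variables (T : finType) (M : matroid T).
Local Notation E := (ground M).
Local Notation r := (rk M E).

(** The zero vectors outside [E] keep frames inside [E] and let sums run over all of [T]. *)
Definition represents (F : fieldType) (n : nat) (v : T -> 'rV[F]_n) : Prop :=
  (forall A : {set T}, A \subset E -> rk M A = \rank (\sum_(e in A) <<v e>>)%MS)
  /\ (forall e, e \notin E -> v e = 0).

(** The vectors are rewritten in coordinates with respect to a basis of their span, whose dimension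
    is [r]. *)
Lemma representable_full (F : fieldType) : representable F M ->
  exists v : T -> 'rV[F]_r, represents v.
Proof.
case=> n [v0 rep]; set V := (\sum_(e in E) <<v0 e>>)%MS.
have Er : r = \rank V by rewrite rep.
rewrite Er; pose v e := if e \in E then v0 e *m pinvmx (row_base V) else 0.
exists v; split=> [A AE|e /negPf eE]; last by rewrite /v eE.
rewrite rep // -[RHS](rank_span_mulr _ _ (row_base_free V)).
congr (\rank _); apply: eq_bigr => e eA; have eE := subsetP AE e eA.
by rewrite /v eE mulmxKpV // eq_row_base sub_span.
Qed.

(** Frames are the ordered bases of [M], whatever the field; this links the representations over [F]
    and over the two-element field. *)
Lemma represents_frame (F : fieldType) (v : T -> 'rV[F]_r) h : represents v ->
  frame v h = (h @: setT \subset E) && (rk M (h @: setT) == r).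
Proof.
move=> [rep out]; rewrite /frame -row_full_unit /row_full (eqmx_rows_of v h).
have [sE|/subsetPn[_ /imsetP[i _ ->] iE]] := boolP (_ \subset _); first by rewrite (rep _ sE).
rewrite -(eqmx_rows_of v h) -[LHS]/(row_full _) row_full_unit -/(frame v h) frame_det.
apply/negbTE/negPn; rewrite (expand_det_row _ i) big1 // => j _.
by rewrite mxE out // mxE mul0r.
Qed.

Lemma represents_full (F : fieldType) (v : T -> 'rV[F]_r) : represents v ->
  exists h, frame v h.
Proof.
move=> [rep _]; have [k [J [kE JE Jfree _]]] := span_basis v E.
rewrite -rep // in kE; subst k.
by exists J; rewrite /frame -row_free_unit.
Qed.

Lemma regular_unimodular (F : fieldType) : regular M ->
  exists2 v : T -> 'rV[F]_r, represents v
    & forall h, frame v h -> \det (rows_of v h) ^+ 2 = 1.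
Proof.
move=> reg; have [v repv] := representable_full (reg F).
have [w repw] := representable_full (reg 'F_2).
have same h : frame v h = frame w h by rewrite (represents_frame _ repv) (represents_frame _ repw).
have K2 (a : 'F_2) : a != 0 -> a = 1.
  by case: a => [[|[|//]] ?] // _; apply: val_inj.
have [f fr] := represents_full repv.
have [t [N [t0 N1 uni]]] := unimodular_frames K2 same fr.
exists (fun x => t x *: v x *m N).
  case: repv => rep out; split=> [A AE|e eE]; last by rewrite out // scaler0 mul0mx.
  by rewrite rank_span_mulr ?row_free_unit // span_scale // rep.
move=> h; rewrite /frame => fh; apply: uni.
have E1 : rows_of (fun x => t x *: v x *m N) h = rows_of (fun x => t x *: v x) h *m N.
  by apply/row_matrixP=> i; rewrite row_mul !rowK.
by move: fh; rewrite E1 unitmx_mul => /andP[+ _]; rewrite -/(frame _ _) frame_scale.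
Qed.

End Regular.

(** * The Cauchy-Binet formula *)

(** Matrix of the quadratic form sum_e alpha_e <x, y_e>^2. *)
Definition gram (F : fieldType) (T : finType) (n : nat) (y : T -> 'rV[F]_n)
  (alpha : T -> F) : 'M[F]_n := \sum_e alpha e *: ((y e)^T *m y e).

Section CauchyBinet.
Variables (F : fieldType) (T : finType) (m : nat) (y : T -> 'rV[F]_m).

(** In the Leibniz expansion each entry is a sum over [T]. Distributing the product yields the
    choice functions [h], and the factors that depend on the permutation form the determinant on the
    right. *)
Lemma det_gram_ffun (alpha : T -> F) : \det (gram y alpha) =
  \sum_(h : {ffun 'I_m -> T})
    (\prod_i (alpha (h i) * y (h i) 0 i)) * \det (rows_of y h).
Proof.
transitivity (\sum_(s : 'S_m) \sum_(h : {ffun 'I_m -> T})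
   (-1) ^+ s * \prod_i ((alpha (h i) * y (h i) 0 i) * y (h i) 0 (s i))).
  apply: eq_bigr => s _; rewrite -big_distrr /=.
  rewrite -(bigA_distr_bigA (fun i e => alpha e * y e 0 i * y e 0 (s i))).
  congr (_ * _); apply: eq_bigr => i _; rewrite summxE; apply: eq_bigr => e _.
  by rewrite mxE mxE big_ord1 mxE mulrA.
rewrite exchange_big; apply: eq_bigr => h _; rewrite big_distrr /=.
apply: eq_bigr => s _; rewrite big_split /= mulrCA; congr (_ * (_ * _)).
by apply: eq_bigr => i _; rewrite mxE.
Qed.

Lemma enum_imset (B : {set T}) : #|B| = m ->
  exists2 h : {ffun 'I_m -> T}, injective h & h @: setT = B.
Proof.
move=> cB; exists [ffun i => enum_val (cast_ord (esym cB) i)].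
  by move=> i j; rewrite !ffunE => /enum_val_inj/cast_ord_inj.
apply/setP=> e; apply/imsetP/idP => [[i _ ->]|eB].
  by rewrite ffunE; apply: enum_valP.
exists (cast_ord cB (enum_rank_in eB e)) => //.
by rewrite ffunE cast_ordK enum_rankK_in.
Qed.

Lemma imset_eq_perm (h k : {ffun 'I_m -> T}) : injective k ->
  k @: setT = h @: setT -> exists s : 'S_m, k = [ffun i => h (s i)].
Proof.
move=> injk im.
have ex i : exists j, k i == h j.
  have : k i \in h @: setT by rewrite -im imset_f.
  by case/imsetP=> j _ ->; exists j.
have inj : injective (fun i => xchoose (ex i)).
  move=> i j /(congr1 h).
  by rewrite -(eqP (xchooseP (ex i))) -(eqP (xchooseP (ex j))) => /injk.
exists (perm inj); apply/ffunP=> i; rewrite ffunE permE.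
exact/eqP/(xchooseP (ex i)).
Qed.

(* [D B] stands for the squared minor on B, which is only defined through an
   enumeration of B. *)
Lemma cauchy_binet (alpha : T -> F) (D : {set T} -> F) :
  (forall h : {ffun 'I_m -> T}, injective h ->
     \det (rows_of y h) ^+ 2 = D (h @: setT)) ->
  \det (gram y alpha) = \sum_(B : {set T} | #|B| == m) D B * \prod_(e in B) alpha e.
Proof.
move=> HD; rewrite det_gram_ffun.
rewrite (bigID (fun h : {ffun 'I_m -> T} => injectiveb h)) /=.
(* A repeated value of [h] gives two equal rows. *)
rewrite [X in _ + X]big1 ?addr0; last first.
  move=> h /injectivePn[i [j ne eq]].
  rewrite (determinant_alternate ne) ?mulr0 // => k.
  by rewrite !mxE eq.
rewrite (partition_big (fun h : {ffun 'I_m -> T} => h @: setT)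
   (fun B : {set T} => #|B| == m)) /=; last first.
  by move=> h /injectiveP inj; rewrite card_imset // cardsT card_ord.
apply: eq_bigr => B /eqP cB; have [h injh imh] := enum_imset cB.
(* The injections with image [B] are the compositions of [h] with permutations. *)
pose tau (s : 'S_m) := [ffun i => h (s i)].
pose sig k := odflt 1%g [pick s | tau s == k].
rewrite (reindex tau) /=; last first.
  exists sig => [s _|k /andP[/injectiveP injk /eqP imk]].
    rewrite /sig; case: pickP => [s' /eqP eq|/(_ s)]; last by rewrite eqxx.
    apply/permP=> i; apply: injh.
    by move/ffunP/(_ i): eq; rewrite !ffunE.
  rewrite /sig; case: pickP => [s' /eqP //|none].
  have [s sE] := imset_eq_perm injk (etrans imk (esym imh)).
  by have := none s; rewrite /tau -sE eqxx.
have tauP s : injectiveb (tau s) && (tau s @: setT == B).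
  apply/andP; split.
    by apply/injectiveP=> i j; rewrite !ffunE => /injh/perm_inj.
  rewrite -imh; apply/eqP/setP=> e; apply/imsetP/imsetP => -[i _ ->].
    by exists (s i); rewrite ?ffunE.
  by exists ((s^-1)%g i); rewrite ?ffunE ?permKV.
rewrite (eq_bigl xpredT) //.
have detE s : \det (rows_of y (tau s)) = (-1) ^+ s * \det (rows_of y h).
  rewrite -det_perm -det_mulmx -row_permE; congr (\det _).
  by apply/matrixP=> i j; rewrite !mxE ffunE.
have prodE s : \prod_i (alpha (tau s i) * y (tau s i) 0 i)
    = (\prod_(e in B) alpha e) * \prod_i y (h (s i)) 0 i.
  rewrite big_split /=; congr (_ * _); last by apply: eq_bigr => i _; rewrite ffunE.
  have /andP[/injectiveP inj /eqP <-] := tauP s.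
  by rewrite big_imset /=; [apply: eq_bigl => i; rewrite inE | move=> ? ? _ _ /inj].
(* Expanding one of the two equal factors of the squared minor matches the sum over permutations. *)
have -> : D B = \sum_(s : 'S_m) (-1) ^+ s * (\prod_i y (h (s i)) 0 i * \det (rows_of y h)).
  rewrite -imh -HD // expr2 -{1}det_tr big_distrl /=; apply: eq_bigr => s _.
  by rewrite -mulrA; congr (_ * (_ * _)); apply: eq_bigr => i _; rewrite !mxE.
rewrite mulrC big_distrr; apply: eq_bigr => s _.
by rewrite prodE detE mulrACA -mulrA.
Qed.

End CauchyBinet.

(** * Contractions and restricted forms *)

(** Multiplying the stacked rows of [J] and [h] by the square matrix with blocks [pinvmx X] and
    [U^T] gives a block triangular matrix with an identity block. Minors of the projected vectors
    are thus a fixed multiple of minors of [v]. *)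
Lemma det_join (F : fieldType) (T : finType) (k m n : nat) (v : T -> 'rV[F]_n)
    (J : 'I_k -> T) (U : 'M[F]_(m, n)) :
  n = (k + m)%N -> row_free (rows_of v J) -> rows_of v J *m U^T = 0 ->
  (forall z : 'rV_n, z *m U^T = 0 -> (z <= rows_of v J)%MS) ->
  exists2 delta, delta != 0 & forall h : 'I_m -> T, exists2 f : 'I_n -> T,
    f @: setT = (J @: setT) :|: (h @: setT)
    & \det (rows_of (fun e => v e *m U^T) h) = delta * \det (rows_of v f).
Proof.
move=> nE; subst n; set X := rows_of v J => freeX XU annU.
pose W : 'M_(k + m) := row_mx (pinvmx X) U^T.
have W1 : W \in unitmx.
  rewrite -row_free_unit; apply: inj_row_free => z.
  rewrite mul_mx_row => /eqP; rewrite row_mx_eq0 => /andP[/eqP z1 /eqP z2].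
  have /submxP[a az] := annU z z2.
  by move: z1; rewrite az -mulmxA mulmxVp // mulmx1 => ->; rewrite mul0mx.
exists (\det W) => [|h]; first by rewrite -unitfE -unitmxE.
exists (fun i => match split i with inl a => J a | inr b => h b end).
  apply/setP=> e; rewrite inE; apply/imsetP/orP => [[i _ ->]|].
    by case: (split i) => a; [left|right]; rewrite imset_f.
  case=> /imsetP[a _ ->].
    by exists (unsplit (inl a)); rewrite ?unsplitK.
  by exists (unsplit (inr a)); rewrite ?unsplitK.
set Y := rows_of v (fun i => _).
have YE : Y = col_mx X (rows_of v h).
  apply/matrixP=> i j; rewrite !mxE; case: (split i) => a; by rewrite mxE.
rewrite mulrC -det_mulmx YE mul_col_row mulmxVp // XU det_lblock det1 mul1r.
congr (\det _); apply/row_matrixP=> i; by rewrite row_mul !rowK.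
Qed.

Lemma gram_mulr (F : fieldType) (T : finType) (m n : nat) (v : T -> 'rV[F]_n)
    (U : 'M[F]_(m, n)) (alpha : T -> F) :
  gram (fun e => v e *m U^T) alpha = U *m gram v alpha *m U^T.
Proof.
rewrite /gram mulmx_sumr mulmx_suml; apply: eq_bigr => e _.
by rewrite -scalemxAr -scalemxAl trmx_mul trmxK !mulmxA.
Qed.

Section ContractionGram.
Variables (F : fieldType) (T : finType) (M : matroid T).
Local Notation E := (ground M).
Local Notation r := (rk M E).
Variable v : T -> 'rV[F]_r.
Hypothesis rep : represents M v.
Hypothesis uni : forall h, frame v h -> \det (rows_of v h) ^+ 2 = 1.

Lemma rk_span_setU (C J B : {set T}) : C \subset E -> B \subset E -> J \subset C ->
  (\sum_(e in C) <<v e>> <= \sum_(e in J) <<v e>>)%MS ->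
  rk M (C :|: B) = rk M (J :|: B).
Proof.
move=> CE BE JC sCJ; apply/eqP; rewrite eqn_leq.
have CBE : C :|: B \subset E by rewrite subUset CE.
rewrite [X in _ && X]rk_mono ?setSU // andbT.
have JBE : J :|: B \subset E by apply: subset_trans CBE; apply: setSU.
rewrite (proj1 rep _ CBE) (proj1 rep _ JBE) mxrankS //; apply/sub_spanP=> e; rewrite inE => /orP[eC|eB].
  apply: submx_trans (sub_span v eC) _; apply: submx_trans sCJ _.
  by apply/sub_spanP=> a aJ; rewrite sub_span // inE aJ.
by rewrite sub_span // inE eB orbT.
Qed.

(* The rows of U form a basis of the common zeros of the v e, e \notin A. *)
Lemma contraction_gram (A : {set T}) : A \subset E ->
  exists m (U : 'M[F]_(m, r)), [/\ m = total_rk (contraction M A), row_free U,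
    forall e, e \in E :\: A -> v e *m U^T = 0
    & exists2 delta, delta != 0 & forall alpha,
      \det (U *m gram v alpha *m U^T)
      = delta ^+ 2 * basis_sum (contraction M A) alpha].
Proof.
move=> AE; set C := E :\: A; have CE : C \subset E by apply: subsetDl.
have [k [J [kE JC freeJ spanJ]]] := span_basis v C.
rewrite -(proj1 rep) // in kE.
(* The columns of [col_base (cokermx X)] form a basis of the vectors orthogonal to all rows of
   [X]. *)
pose X := rows_of v J; pose U := (col_base (cokermx X))^T.
have mE : \rank (cokermx X) = (r - k)%N by rewrite mxrank_coker (eqP freeJ).
have kr : (k <= r)%N by rewrite kE rk_mono.
have XU : X *m U^T = 0.
  apply: (row_free_inj (row_base_free (cokermx X))) => /=.
  by rewrite trmxK -mulmxA mulmx_base mul0mx mulmx_coker.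
have annU (z : 'rV_r) : z *m U^T = 0 -> (z <= X)%MS.
  rewrite trmxK submxE => zc; apply/eqP.
  transitivity (z *m col_base (cokermx X) *m row_base (cokermx X)).
    by rewrite -mulmxA mulmx_base.
  by rewrite zc mul0mx.
have killC e : e \in C -> v e *m U^T = 0.
  move=> eC; have : (v e <= X)%MS by rewrite spanJ sub_span.
  by case/submxP=> a ->; rewrite -mulmxA XU mulmx0.
have kmE : r = (k + \rank (cokermx X))%N by rewrite mE subnKC.
have [delta d0 Hd] := det_join kmE freeJ XU annU.
exists (\rank (cokermx X)), U; split=> //.
- by rewrite mE total_rk_contraction // -kE.
- by rewrite /row_free mxrank_tr; have := col_base_full (cokermx X).
exists delta => // alpha; rewrite -gram_mulr.
(* By Cauchy-Binet it suffices that the squared minor on [B] is [delta ^+ 2] when [B] is a basis of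
   the contraction, and 0 otherwise. *)
rewrite (@cauchy_binet _ _ _ _ _
  (fun B => delta ^+ 2 * (basis (contraction M A) B)%:R)); last first.
  move=> h injh; have [f imf ->] := Hd h; rewrite exprMn; congr (_ * _).
  set B := h @: setT.
  have cB : #|B| = (r - k)%N by rewrite card_imset // cardsT card_ord mE.
  have imJ : J @: setT \subset C by apply/subsetP=> _ /imsetP[i _ ->].
  have sCJ : (\sum_(e in C) <<v e>> <= \sum_(e in J @: setT) <<v e>>)%MS.
    by rewrite -(eqmx_rows_of v J) spanJ.
  have EA : E :&: A = A by apply/setIidPr.
  have rkA : contr_rk M A A = (r - k)%N by rewrite /contr_rk setDU_sub // -/C -kE.
  (* [B] is a basis of the contraction exactly when [J] and [B] together give a basis of [M], that
     is, when [f] is a frame. *)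
  have [fr|nfr] := boolP (frame v f).
    have : \det (rows_of (fun e => v e *m U^T) h) != 0.
      have [f' imf' ->] := Hd h; rewrite mulf_neq0 // -frame_det.
      by rewrite (represents_frame _ rep) imf' -imf -(represents_frame _ rep).
    rewrite uni // => nz.
    have := fr; rewrite (represents_frame _ rep) imf subUset => /andP[/andP[_ BE] rkJB].
    (* An element of [B] outside [A] would give a zero row. *)
    have BA : B \subset A.
      apply/subsetP=> _ /imsetP[i _ ->]; apply: contraNT nz => iA.
      have iC : h i \in C by rewrite inE iA (subsetP BE) // imset_f.
      rewrite (expand_det_row _ i) big1 // => j _.
      by rewrite mxE killC // mxE mul0r.
    rewrite /basis /= EA BA rkA cB eqxx andbT /= /contr_rk -/C.
    by rewrite (rk_span_setU CE BE imJ sCJ) (eqP rkJB) -kE eqxx.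
  have : ~~ basis (contraction M A) B.
    apply: contra nfr => /and3P[/= BA rkB _]; rewrite EA in BA.
    have BE := subset_trans BA AE.
    rewrite (represents_frame _ rep) imf subUset (subset_trans imJ CE) BE /=.
    rewrite -(rk_span_setU CE BE imJ sCJ).
    move: rkB; rewrite /contr_rk -/C cB -kE.
    have : (k <= rk M (C :|: B))%N by rewrite kE rk_mono ?subsetUl // subUset CE.
    by move=> h1 /eqP h2; apply/eqP; lia.
  move/negPf->; move: nfr; rewrite frame_det negbK => /eqP->.
  by rewrite expr0n.
rewrite /basis_sum big_distrr /= [LHS]big_mkcond [RHS]big_mkcond /=.
apply: eq_bigr => B _; have [bB|_] := ifP (basis (contraction M A) B).
  rewrite mulr1 ifT // mE; case/and3P: bB => _ _ /eqP ->.
  by rewrite [rk _ _](total_rk_contraction AE) -kE.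
by rewrite mulr0 mul0r; case: ifP.
Qed.

End ContractionGram.

(** * The rank of [Q_alpha] *)

Lemma gram_sym (F : fieldType) (T : finType) (n : nat) (v : T -> 'rV[F]_n)
  (alpha : T -> F) : (gram v alpha)^T = gram v alpha.
Proof.
rewrite /gram raddf_sum; apply: eq_bigr => e _ /=.
by rewrite linearZ /= trmx_mul trmxK.
Qed.

(** By dimension, the row space of [U] and the radical of [K] span everything. A vector of the row
    space that is orthogonal to the row space is then orthogonal to all vectors, so it lies in the
    radical and vanishes. *)
Lemma radical_split (F : fieldType) (m n : nat) (K : 'M[F]_n) (U : 'M[F]_(m, n)) :
  K^T = K -> row_free U -> (\rank K <= m)%N ->
  (forall y : 'rV_n, (y <= U)%MS -> y *m K = 0 -> y = 0) ->
  U *m K *m U^T \in unitmx.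
Proof.
move=> symK freeU rkm triv.
have cap0 : (U :&: kermx K)%MS = 0.
  apply/eqP/rowV0P => y; rewrite sub_capmx => /andP[yU /sub_kermxP]; exact: triv.
have full : row_full (U + kermx K)%MS.
  rewrite /row_full mxrank_disjoint_sum // mxrank_ker (eqP freeU).
  have := rank_leq_col (U + kermx K)%MS; rewrite mxrank_disjoint_sum // mxrank_ker (eqP freeU).
  have := rank_leq_row K; lia.
rewrite -row_free_unit; apply: inj_row_free => z zK.
set s := z *m U *m K.
have s0 : s = 0.
  apply: trmx_inj; rewrite trmx0 -[LHS]mul1mx; apply/sub_kermxP.
  have s1 : (1%:M <= U + kermx K)%MS by rewrite sub1mx.
  apply: submx_trans s1 _; rewrite addsmx_sub; apply/andP; split; apply/sub_kermxP.
    by apply: trmx_inj; rewrite trmx_mul trmxK trmx0 /s -zK !mulmxA.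
  by rewrite /s trmx_mul symK mulmxA mulmx_ker mul0mx.
have : z *m U = 0 by apply: triv => //; apply: submxMl.
by move/eqP; rewrite mulmx_free_eq0 // => /eqP.
Qed.

Section AperpRank.
Variables (F : fieldType) (T : finType) (M : matroid T).
Local Notation E := (ground M).
Local Notation r := (rk M E).
Variable v : T -> 'rV[F]_r.
Hypothesis rep : represents M v.
Hypothesis uni : forall h, frame v h -> \det (rows_of v h) ^+ 2 = 1.

Lemma separating_set (K : 'M[F]_r) : exists C : {set T},
  [/\ C \subset E, (#|C| <= r - \rank K)%N
    & forall y : 'rV_r, y *m K = 0 ->
      (forall e, e \in C -> v e *m y^T = 0) -> y = 0].
Proof.
pose N := row_base (kermx K).
have [k [J [kE JE _ spanJ]]] := span_basis (fun e => v e *m N^T) E.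
have rkN : \rank (kermx K) = (r - \rank K)%N by rewrite mxrank_ker.
have full : row_full (\sum_(e in E) <<v e>>)%MS by rewrite /row_full -(proj1 rep).
have spanE : (\sum_(e in E) <<v e *m N^T>> :=: N^T)%MS.
  apply: eqmx_trans (eqmxMfull _ full); apply: eqmx_sym.
  apply: eqmx_trans (sumsmxMr_gen _ _ _) _; apply: eqmx_sums => e _.
  by apply: eqmx_trans (genmxE _) _; apply: eqmx_trans (eqmx_sym (genmxE _)); apply/eqmxMr/genmxE.
exists (J @: setT); split.
- by apply/subsetP=> _ /imsetP[i _ ->].
- apply: leq_trans (leq_imset_card _ _) _.
  by rewrite cardsT card_ord kE spanE mxrank_tr -rkN rank_leq_row.
move=> y /sub_kermxP; rewrite -(eq_row_base (kermx K)) => /submxP[a yE] kill.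
suff a0 : a^T = 0 by rewrite yE -[a]trmxK a0 trmx0 mul0mx.
have fullJ : row_full (rows_of (fun e => v e *m N^T) J).
  by rewrite /row_full spanJ spanE mxrank_tr; apply: row_base_free.
have /row_fullP[B BJ] := fullJ.
rewrite -[LHS]mul1mx -BJ -mulmxA (_ : rows_of _ _ *m a^T = 0) ?mulmx0 //.
apply/row_matrixP=> i; rewrite row_mul rowK row0.
by have := kill (J i) (imset_f _ (in_setT i)); rewrite yE trmx_mul mulmxA.
Qed.

(** The restriction to [U] is nondegenerate, so the rank of K is at least [m]. Conversely, the
    complement of a set [C] separating the radical also has nonzero basis sum; maximality gives r(E
    \ A) <= |E \ A| <= |C| <= r - rank K, hence rank K <= m. *)
Lemma Aperp_gram (alpha : T -> F) (A : {set T}) : is_Aperp M alpha A ->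
  exists m (U : 'M[F]_(m, r)), [/\ m = total_rk (contraction M A),
    \rank (gram v alpha) = m
    & exists2 delta, delta != 0 & \det (U *m gram v alpha *m U^T)
      = delta ^+ 2 * basis_sum (contraction M A) alpha].
Proof.
case=> AE nz maxA; set K := gram v alpha.
have [m [U [mE freeU killU [delta d0 dE]]]] := contraction_gram rep uni AE.
exists m, U; split=> //; last by exists delta; last exact: dE.
apply/eqP; rewrite eqn_leq; apply/andP; split; last first.
  have KU : U *m K *m U^T \in unitmx by rewrite unitmxE dE unitfE mulf_neq0 // sqrf_eq0.
  rewrite -[X in (X <= _)%N](mxrank_unit KU).
  by apply: leq_trans (mxrankM_maxl _ _) (mxrankM_maxr _ _).
have [C [CE cC sep]] := separating_set K.
have A'E : E :\: C \subset E by apply: subsetDl.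
have EC : E :\: (E :\: C) = C by rewrite setDDr setDv set0U; apply/setIidPr.
have [m' [U' [m'E freeU' killU' [delta' d'0 d'E]]]] := contraction_gram rep uni A'E.
rewrite EC in killU'.
rewrite total_rk_contraction // EC in m'E.
have rkC := rk_card CE; have rkK := rank_leq_row K.
have KU' : U' *m K *m U'^T \in unitmx.
  apply: radical_split => //; first exact: gram_sym.
    lia.
  move=> y /submxP[a yE] yK; apply: sep => // e eC.
  by rewrite yE trmx_mul mulmxA killU' // mul0mx.
have nz' : basis_sum (contraction M (E :\: C)) alpha != 0.
  by move: KU'; rewrite unitmxE d'E unitfE mulf_eq0 negb_or => /andP[].
have := maxA _ A'E nz'.
rewrite total_rk_contraction // in mE.
have := rk_card (subsetDl E A).
rewrite !cardsD (setIidPr CE) (setIidPr AE).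
have := subset_leq_card CE; have := subset_leq_card AE; lia.
Qed.

End AperpRank.

(** * The quadratic character *)

Section QuadraticCharacter.
Variable F : finFieldType.
Hypothesis odd_card : odd #|F|.
Local Notation q := #|F|.

Lemma exists_primitive : exists z : F, q.-1.-primitive_root z.
Proof.
have q1 : (1 < q)%N := finNzRing_gt1 F.
have q0 : (0 < q.-1)%N by rewrite -ltnS prednK // ltnW.
pose rs := [seq x <- enum F | x != 0].
have : has q.-1.-primitive_root rs.
  apply: has_prim_root => //.
  - apply/allP=> x; rewrite mem_filter => /andP[x0 _]; apply/unity_rootP.
    apply: (mulfI x0); rewrite mulr1 -exprS prednK ?expf_card //.
    exact: ltnW.
  - by rewrite filter_uniq // enum_uniq.
  - rewrite size_filter -(cardC1 (0 : F)) cardE /enum_mem size_filter.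
    by rewrite count_filter; apply: eq_leq; apply: eq_count => x; rewrite !inE andbT.
by case/hasP=> z _ pz; exists z.
Qed.

Lemma eta0 : eta (0 : F) = 0.
Proof. by rewrite /eta eqxx. Qed.

Lemma half_cardE : q.-1 = (q./2).*2.
Proof.
by have := odd_double_half q; rewrite odd_card add1n => <- /=; rewrite uphalf_double.
Qed.

Section Generator.
Variable z : F.
Hypothesis z_prim : q.-1.-primitive_root z.

Lemma generator_pow (x : F) : x != 0 -> exists i, x = z ^+ i.
Proof.
move=> x0; have [|i ->] := prim_rootP z_prim (x := x); last by exists i.
apply: (mulfI x0); rewrite mulr1 -exprS prednK ?expf_card //.
exact: ltnW (finNzRing_gt1 F).
Qed.

Lemma generator_neq0 i : z ^+ i != 0.
Proof.
rewrite expf_neq0 //; apply/eqP=> z0; have := prim_expr_order z_prim.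
have := prim_order_gt0 z_prim; case: q.-1 => // n _.
by rewrite z0 expr0n => /eqP; rewrite eq_sym oner_eq0.
Qed.

(** As q - 1 is even, the parity of the exponent of a generator is well defined, and the nonzero
    squares are the even powers. *)
Lemma eta_generator i : eta (z ^+ i) = (-1) ^+ i.
Proof.
rewrite /eta (negPf (generator_neq0 i)) -signr_odd.
have -> : [exists y, z ^+ i == y ^+ 2] = ~~ odd i; last by case: (odd i).
apply/existsP/idP => [[y /eqP E]|ev].
  have y0 : y != 0.
    by apply: contraNneq (generator_neq0 i) => y0; rewrite E y0 expr0n.
  have [j yE] := generator_pow y0.
  move/eqP: E; rewrite yE -exprM (eq_prim_root_expr z_prim) => /eqP.
  rewrite half_cardE => /(congr1 odd); rewrite !odd_mod ?odd_double //.
  by rewrite oddM andbF => ->.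
by exists (z ^+ i./2); rewrite -exprM muln2 even_halfK.
Qed.

Lemma generator_half : z ^+ q./2 = -1.
Proof.
have half0 : (0 < q./2)%N.
  by have := prim_order_gt0 z_prim; rewrite half_cardE double_gt0.
have : (z ^+ q./2) ^+ 2 == 1.
  by rewrite -exprM muln2 -half_cardE (prim_expr_order z_prim).
rewrite sqrf_eq1 -(prim_order_dvd z_prim) half_cardE => /orP[|/eqP //].
by move/(dvdn_leq half0); rewrite -addnn leqNgt -addn1 leq_add2l half0.
Qed.

End Generator.

Lemma eta_mul (x y : F) : eta (x * y) = eta x * eta y.
Proof.
have [->|x0] := eqVneq x 0; first by rewrite mul0r eta0 mul0r.
have [->|y0] := eqVneq y 0; first by rewrite mulr0 eta0 mulr0.
have [z pz] := exists_primitive.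
have [i ->] := generator_pow pz x0; have [j ->] := generator_pow pz y0.
by rewrite -exprD !eta_generator // exprD.
Qed.

Lemma eta_sq (x : F) : x != 0 -> eta x * eta x = 1.
Proof.
move=> x0; have [z pz] := exists_primitive; have [i ->] := generator_pow pz x0.
by rewrite eta_generator // -expr2 sqrr_sign.
Qed.

Lemma eta_sqr (x : F) : x != 0 -> eta (x ^+ 2) = 1.
Proof. by move=> x0; rewrite expr2 eta_mul eta_sq. Qed.

Lemma eta1 : eta (1 : F) = 1.
Proof. by rewrite -(expr1n _ 2) eta_sqr ?oner_neq0. Qed.

Lemma eta_inv (x : F) : eta x^-1 = eta x.
Proof.
have [->|x0] := eqVneq x 0; first by rewrite invr0.
by rewrite -[LHS]mulr1 -(eta_sq x0) mulrA -eta_mul mulVf // eta1 mul1r.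
Qed.

Lemma etaN1 : eta (-1 : F) = (-1) ^+ (q %% 4 != 1)%N.
Proof.
(* -1 is the power [q./2] of a generator, and this exponent is even exactly when q = 1 mod 4. *)
have [z pz] := exists_primitive; rewrite -(generator_half pz) eta_generator //.
rewrite -signr_odd; congr ((-1) ^+ nat_of_bool _).
by have := odd_card; have := odd_double_half q; lia.
Qed.

Lemma oner_neqN1 : (1 : F) != -1.
Proof.
have [z pz] := exists_primitive; rewrite -(generator_half pz) eq_sym.
rewrite -(prim_order_dvd pz) half_cardE.
have half0 : (0 < q./2)%N.
  by have := prim_order_gt0 pz; rewrite half_cardE double_gt0.
by apply/negP=> /(dvdn_leq half0); lia.
Qed.

Lemma card_sqr (u : F) : #|[set x : F | x ^+ 2 == u]|%:R = 1 + eta u :> rat.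
Proof.
have [->|u0] := eqVneq u 0.
  rewrite eta0 addr0 (_ : [set _ | _] = [set 0]) ?cards1 //.
  by apply/setP=> x; rewrite !inE sqrf_eq0.
rewrite /eta (negPf u0); case: ifP => [/existsP[y /eqP uE]|none].
  rewrite (_ : [set _ | _] = [set y; - y]); last first.
    by apply/setP=> x; rewrite !inE uE eqf_sqr.
  rewrite cards2 (_ : y != - y) //.
  have y0 : y != 0 by apply: contraNneq u0 => y0; rewrite uE y0 expr0n.
  rewrite -[X in X != _]mulr1 -mulrN1 (inj_eq (mulfI y0)).
  exact: oner_neqN1.
rewrite (_ : [set _ | _] = set0) ?cards0 ?subrr //.
apply/setP=> x; rewrite !inE; apply: contraFF none => /eqP <-.
by apply/existsP; exists x.
Qed.

(** Each [s] has [1 + eta s] square roots. *)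
Lemma sum_sqr (phi : F -> rat) : \sum_x phi (x ^+ 2) = \sum_s (1 + eta s) * phi s.
Proof.
rewrite (partition_big (fun x => x ^+ 2) xpredT) //=.
apply: eq_bigr => s _; rewrite -card_sqr -sum1_card natr_sum mulr_suml.
rewrite [RHS](eq_bigl (fun x => x ^+ 2 == s)) => [|x]; last by rewrite inE.
by apply: eq_bigr => x /eqP ->; rewrite mul1r.
Qed.

Lemma sum_eta : \sum_(s : F) eta s = 0.
Proof.
have := sum_sqr (fun=> 1); under [RHS]eq_bigr => s _ do rewrite mulr1.
by rewrite big_split /= -[LHS]addr0 => /addrI <-.
Qed.

(** A Jacobi sum. If [t] is not 0, dividing by the square of [s] and substituting [t / s] turns it
    into the sum of [eta] over all elements but -1. *)
Lemma sum_eta_mul (t : F) :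
  \sum_s eta s * eta (t - s) = eta (-1 : F) * (q%:R * (t == 0)%:R - 1).
Proof.
have [->|t0] := eqVneq t 0.
  rewrite mulr1 (bigD1 0) //= eta0 mul0r add0r.
  under eq_bigr => s s0 do rewrite sub0r -mulN1r eta_mul mulrCA eta_sq // mulr1.
  rewrite sumr_const cardC1 -[LHS]mulr_natr; congr (_ * _).
  by rewrite -[X in X%:R - 1](prednK (ltnW (finNzRing_gt1 F))) -addn1 natrD addrK.
rewrite mulr0 sub0r mulrN1 (bigD1 0) //= eta0 mul0r add0r.
transitivity (\sum_(s : F | s != 0) eta (s - 1)).
  rewrite [RHS](reindex_onto (fun s => t / s) (fun s => t / s)) /=; last first.
    by move=> s s0; rewrite invf_div mulrCA mulfV // mulr1.
  apply: eq_big => [s|s s0].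
    have [->|s0] := eqVneq s 0; first by rewrite invr0 mulr0 eqxx.
    by rewrite mulf_neq0 ?invr_neq0 //= invf_div mulrCA mulfV // mulr1 eqxx.
  have -> : t - s = s * (t / s - 1) by rewrite mulrBr mulr1 mulrCA mulfV // mulr1.
  by rewrite eta_mul mulrA eta_sq // mul1r.
have := sum_eta; rewrite (reindex_inj (addIr (-1 : F))) /= (bigD1 0) //= add0r.
by move/eqP; rewrite addrC addr_eq0 => /eqP.
Qed.

End QuadraticCharacter.

(** * Counting zeros of quadratic forms *)

Definition form_count (F : finFieldType) (n : nat) (K : 'M[F]_n) (t : F) : nat :=
  #|[set y : 'rV[F]_n | (y *m K *m y^T) 0 0 == t]|.

Section QuadraticForms.
Variable F : finFieldType.
Hypothesis odd_card : odd #|F|.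
Local Notation q := (#|F|%:R : rat).

Lemma card_field_neq0 : q != 0.
Proof. by rewrite Num.Theory.pnatr_eq0 -lt0n ltnW // finNzRing_gt1. Qed.

Lemma form_count_congr n (W K : 'M[F]_n) t : W \in unitmx ->
  form_count (W *m K *m W^T) t = form_count K t.
Proof.
move=> W1; rewrite /form_count -[RHS](card_preimset _ (can_inj (mulmxK W1))).
by apply: eq_card => y; rewrite !inE trmx_mul !mulmxA.
Qed.

(** If the form vanished, polarization would give b = -b for every value b of the bilinear form; as
    1 and -1 differ, this forces K = 0. *)
Lemma form_neq0 n (K : 'M[F]_n.+1) : K^T = K -> K \in unitmx ->
  exists y : 'rV_n.+1, (y *m K *m y^T) 0 0 != 0.
Proof.
move=> symK K1; have [y yK|z] := pickP (fun y : 'rV_n.+1 => (y *m K *m y^T) 0 0 != 0).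
  by exists y.
have {}z (y : 'rV_n.+1) : y *m K *m y^T = 0.
  by apply/rowP=> i; rewrite (ord1 i) [RHS]mxE; have /negbFE/eqP := z y.
have sym (x y : 'rV_n.+1) : x *m K *m y^T = y *m K *m x^T.
  have <- : (x *m K *m y^T)^T = y *m K *m x^T by rewrite !trmx_mul trmxK symK mulmxA.
  by apply/matrixP=> i j; rewrite [RHS]mxE !ord1.
have bil (x y : 'rV_n.+1) : x *m K *m y^T = 0.
  have := z (x + y); rewrite linearD /= !mulmxDl !mulmxDr !z addr0 add0r.
  rewrite (sym y x) => /eqP; rewrite addr_eq0 => /eqP E.
  have /eqP cc : (x *m K *m y^T) 0 0 = - (x *m K *m y^T) 0 0 by rewrite {1}E mxE.
  apply/rowP=> i; rewrite (ord1 i) [RHS]mxE; apply/eqP; apply: contraTT cc => c0.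
  by rewrite -[X in X != _]mulr1 -mulrN1 (inj_eq (mulfI c0)) oner_neqN1.
have K0 : K = 0.
  apply/matrixP=> i j; have := bil (delta_mx 0 i) (delta_mx 0 j).
  by rewrite trmx_delta -rowE -colE => /matrixP/(_ 0 0); rewrite !mxE.
by move: K1; rewrite K0 unitmxE det0 unitr0.
Qed.

(** A vector [y] of nonzero value splits off; [Z] is a basis of its orthogonal complement. *)
Lemma orthogonal_step n (K : 'M[F]_n.+1) : K^T = K -> K \in unitmx ->
  exists (W : 'M[F]_n.+1) (a : F) (K' : 'M[F]_n),
    [/\ W \in unitmx, a != 0, K'^T = K', K' \in unitmx
      & W *m K *m W^T = block_mx (a%:M : 'M_1) 0 0 K' :> 'M_(1 + n)].
Proof.
move=> symK K1; have [y y0] := form_neq0 symK K1.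
pose b := K *m y^T; set a := (y *m K *m y^T) 0 0 in y0.
have yb : y *m b = a%:M by rewrite mulmxA [LHS]mx11_scalar.
have rkb : \rank b = 1%N.
  apply/eqP; rewrite eqn_leq rank_leq_col lt0n mxrank_eq0; apply: contraNneq y0 => b0.
  by rewrite /a -mulmxA -/b b0 mulmx0 mxE.
have [Z freeZ Zb] : exists2 Z : 'M[F]_(n, n.+1), row_free Z & Z *m b = 0.
  have rk : \rank (kermx b) = n by rewrite mxrank_ker rkb subn1.
  have : exists2 Z : 'M[F]_(\rank (kermx b), n.+1), row_free Z & Z *m b = 0.
    exists (row_base (kermx b)); first exact: row_base_free.
    by apply/sub_kermxP; rewrite eq_row_base.
  by rewrite rk.
have bZ : y *m K *m Z^T = 0.
  by apply: trmx_inj; rewrite !trmx_mul trmxK symK trmx0.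
pose W : 'M_(1 + n) := col_mx y Z.
have W1 : W \in unitmx.
  rewrite -row_free_unit; apply: inj_row_free => u.
  rewrite -[u]hsubmxK mul_row_col => E.
  have u1 : lsubmx u = 0.
    have := congr1 (mulmx^~ b) E; rewrite mulmxDl -!mulmxA Zb mulmx0 addr0 mul0mx yb.
    rewrite mul_mx_scalar => /eqP; rewrite scaler_eq0 (negPf y0) /= => /eqP //.
  move: E; rewrite u1 mul0mx add0r => /eqP; rewrite mulmx_free_eq0 // => /eqP ->.
  by rewrite row_mx0.
have WKW : W *m K *m W^T = block_mx (a%:M : 'M_1) 0 0 (Z *m K *m Z^T) :> 'M_(1 + n).
  rewrite mul_col_mx tr_col_mx mul_col_row bZ -!mulmxA Zb.
  by rewrite -/b yb.
exists W, a, (Z *m K *m Z^T); split=> //; first by rewrite !trmx_mul trmxK symK mulmxA.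
have : W *m K *m W^T \in unitmx by rewrite !unitmx_mul unitmx_tr W1 K1.
by rewrite WKW !unitmxE det_ublock unitrM => /andP[].
Qed.

Lemma form_count_block n (a : F) (K : 'M[F]_n) t :
  form_count (block_mx (a%:M : 'M_1) 0 0 K : 'M_(1 + n)) t
  = (\sum_(x : F) form_count K (t - a * x ^+ 2)%R)%N.
Proof.
rewrite /form_count -sum1_card.
rewrite (partition_big (fun y : 'rV_(1 + n) => y 0 (lshift n 0)) xpredT) //=.
apply: eq_bigr => x _; rewrite -sum1_card.
rewrite (reindex_onto (fun z : 'rV[F]_n => row_mx (x%:M : 'M_1) z)
   (fun y : 'rV_(1 + n) => rsubmx y)) /=; last first.
  move=> y /andP[_ /eqP yx]; rewrite -[RHS]hsubmxK; congr row_mx.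
  by apply/matrixP=> i j; rewrite !ord1 !mxE yx.
apply: eq_bigl => z; rewrite !inE row_mxKr.
have -> : row_mx x%:M z 0 (lshift n 0) = x by rewrite row_mxEl mxE eqxx.
rewrite !eqxx !andbT mul_row_block tr_row_mx mul_row_col !mulmx0 addr0 add0r mxE.
have -> : ((x%:M : 'M_1) *m a%:M *m (x%:M)^T) 0 0 = a * x ^+ 2.
  by rewrite tr_scalar_mx -!scalar_mxM mxE eqxx mulr1n; ring.
by rewrite [RHS]eq_sym subr_eq eq_sym addrC.
Qed.

(** Deviation from q^(n-1) of the number of solutions of Q = t, for a nondegenerate form Q of
    determinant 1 in [n] variables. *)
Definition form_error (n : nat) (t : F) : rat :=
  if odd n then eta (-1 : F) ^+ n./2 * eta t * q ^+ n./2
  else eta (-1 : F) ^+ n./2 * (q * (t == 0)%:R - 1) * q ^+ n./2 / q.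

Lemma sum_form_error n (a t : F) : a != 0 -> \sum_s form_error n (t - a * s) = 0.
Proof.
move=> a0; have inj : injective (fun s : F => t - a * s).
  by move=> x y /addrI/oppr_inj/(mulfI a0).
have <- : \sum_u form_error n u = \sum_s form_error n (t - a * s).
  exact: (reindex_inj inj).
rewrite /form_error.
case: (odd n); first by rewrite -mulr_suml -mulr_sumr sum_eta // mulr0 mul0r.
rewrite -!mulr_suml -mulr_sumr sumrB sumr_const (bigD1 0) //= eqxx mulr1.
rewrite big1 => [|u /negPf ->]; last by rewrite mulr0.
by rewrite addr0 subrr mulr0 !mul0r.
Qed.

(** Passage from [n] to [n + 1] variables. For odd [n] it is the Jacobi sum [sum_eta_mul]; for even
    [n] only the term with a s = t survives, next to a sum of [eta] that is 0. *)
Lemma sum_eta_form_error n (a t : F) : a != 0 ->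
  \sum_s eta s * form_error n (t - a * s) = eta a * form_error n.+1 t.
Proof.
move=> a0; have q0 := card_field_neq0.
rewrite /form_error /= uphalf_half; have [on|en] := boolP (odd n).
  have inj : injective (fun s : F => a * s) := mulfI a0.
  transitivity (\sum_s eta a * (eta (-1 : F) ^+ n./2 * q ^+ n./2)
      * (eta (a * s) * eta (t - a * s))).
    apply: eq_bigr => s _; rewrite (eta_mul odd_card a s).
    by rewrite -[LHS]mul1r -(eta_sq odd_card a0); ring.
  have sumE : \sum_w eta w * eta (t - w) = \sum_s eta (a * s) * eta (t - a * s).
    exact: (reindex_inj inj).
  rewrite -mulr_sumr -sumE.
  by rewrite sum_eta_mul // add1n !exprS /=; field.
transitivity (\sum_s eta (-1 : F) ^+ n./2 * q ^+ n./2 / q *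
   (q * (eta s * (s == t / a)%:R) - eta s)).
  apply: eq_bigr => s _.
  have -> : (t - a * s == 0) = (s == t / a).
    by rewrite subr_eq0 eq_sym [s == _]eq_sym (can2_eq (divfK a0) (mulfK a0)) mulrC eq_sym.
  by field.
rewrite -mulr_sumr sumrB sum_eta // subr0 -mulr_sumr (bigD1 (t / a)) //= eqxx mulr1.
rewrite big1 => [|s /negPf ->]; last by rewrite mulr0.
by rewrite addr0 eta_mul // eta_inv // add0n /=; field.
Qed.

(** Induction on [n]: after splitting off a x^2, the sum over squares gets the weights [1 + eta s],
    and only the main term and [sum_eta_form_error] remain. [q ^+ n / q] stands for q^(n-1), also
    when n = 0. *)
Lemma form_countE n (K : 'M[F]_n) t : K^T = K -> K \in unitmx ->
  (form_count K t)%:R = q ^+ n / q + eta (\det K) * form_error n t.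
Proof.
elim: n K t => [|n IHn] K t symK K1.
  rewrite det_mx00 eta1 // /form_error /= !expr0 /form_count.
  have q0 := card_field_neq0; transitivity ((t == 0)%:R : rat); last by field.
  have [->|t0] := eqVneq t 0.
    rewrite (_ : [set _ | _] = setT) ?cardsT ?card_mx ?muln0 //.
    by apply/setP=> y; rewrite !inE [y]thinmx0 !mul0mx mxE eqxx.
  rewrite (_ : [set _ | _] = set0) ?cards0 //.
  by apply/setP=> y; rewrite !inE [y]thinmx0 !mul0mx mxE eq_sym (negPf t0).
have [W [a [K' [W1 a0 symK' K'1 WKW]]]] := orthogonal_step symK K1.
have etaE : eta (\det K) = eta a * eta (\det K').
  rewrite -eta_mul // -(det_scalar1 a) -(det_ublock _ 0) -WKW.
  rewrite !det_mulmx det_tr mulrAC mulrC -expr2 eta_mul // eta_sqr ?mulr1 //.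
  by rewrite -unitfE -unitmxE.
rewrite -(form_count_congr _ _ W1) WKW form_count_block natr_sum etaE.
under eq_bigr => x _ do rewrite IHn //.
rewrite (sum_sqr odd_card
  (fun s => q ^+ n / q + eta (\det K') * form_error n (t - a * s))).
transitivity (\sum_(s : F) (q ^+ n / q + q ^+ n / q * eta s
  + eta (\det K') * form_error n (t - a * s)
  + eta (\det K') * (eta s * form_error n (t - a * s)))).
  by apply: eq_bigr => s _; ring.
have sum1 : \sum_(s : F) q ^+ n / q = q * (q ^+ n / q).
  by rewrite sumr_const mulr_natl.
rewrite !big_split /= sum1 -!mulr_sumr sum_eta // sum_form_error // sum_eta_form_error //.
rewrite exprS.
by have := card_field_neq0 => q0; field.
Qed.

End QuadraticForms.

(** * Degenerate forms *)

Lemma card_kernel (F : finFieldType) m n (A : 'M[F]_(m, n)) :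
  #|[set u : 'rV_m | u *m A == 0]| = (#|F| ^ (m - \rank A))%N.
Proof.
rewrite -mxrank_ker -card_rowg; apply: eq_card => u; rewrite !inE.
exact/eqP/sub_kermxP.
Qed.

Section FormZeros.
Variable F : finFieldType.
Hypothesis odd_card : odd #|F|.
Local Notation q := (#|F|%:R : rat).

(** The row space of [U] complements the radical, so the value of the form depends only on the
    component in [U]; vectors with the same component form a coset of the radical, with q^(n - m)
    elements. *)
Lemma form_count_singular m n (K : 'M[F]_n) (U : 'M[F]_(m, n)) t :
  K^T = K -> \rank K = m -> U *m K *m U^T \in unitmx ->
  form_count K t = (#|F| ^ (n - m) * form_count (U *m K *m U^T) t)%N.
Proof.
move=> symK rkK; set L := U *m K *m U^T => L1.
have rkKU : \rank (K *m U^T) = m.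
  apply/eqP; rewrite eqn_leq rank_leq_col /= -[X in (X <= _)%N](mxrank_unit L1).
  by rewrite /L -mulmxA mxrankM_maxr.
(* The kernel of [K *m U^T] contains that of [K] and has the same dimension. *)
have kerE (y : 'rV_n) : y *m K *m U^T = 0 -> y *m K = 0.
  rewrite -mulmxA => /sub_kermxP yK; apply/sub_kermxP; apply: submx_trans yK _.
  rewrite -(mxrank_leqif_sup _).2 ?mxrank_ker ?rkKU ?rkK //.
  by apply/sub_kermxP; rewrite mulmxA mulmx_ker mul0mx.
(* Coordinates of the projection onto the row space of [U] along the radical. *)
pose phi (y : 'rV_n) : 'rV_m := y *m K *m U^T *m invmx L.
have split_y y : (y - phi y *m U) *m K = 0.
  apply: kerE; rewrite !mulmxBl.
  have -> : phi y *m U *m K *m U^T = phi y *m L by rewrite /L !mulmxA.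
  by rewrite /phi mulmxKV // subrr.
have formE y : y *m K *m y^T = phi y *m L *m (phi y)^T.
  have E : y *m K = phi y *m U *m K.
    by apply/eqP; rewrite -subr_eq0 -mulmxBl split_y.
  have E' : K *m y^T = K *m U^T *m (phi y)^T.
    by apply: trmx_inj; rewrite [LHS]trmx_mul [RHS]trmx_mul !trmxK symK E trmx_mul trmxK symK mulmxA.
  by rewrite E -mulmxA E' /L !mulmxA.
have -> : (#|F| ^ (n - m))%N = #|[set u : 'rV_n | u *m K == 0]| by rewrite card_kernel rkK.
rewrite /form_count -sum1_card.
rewrite (partition_big phi (fun z => (z *m L *m z^T) 0 0 == t)) /=; last first.
  by move=> y; rewrite inE formE.
rewrite mulnC -[X in (X * _)%N]sum1_card big_distrl /=.
apply: eq_big => [z|z zt]; first by rewrite inE.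
rewrite mul1n sum1_card.
rewrite -[RHS](card_preimset _ (addIr (- (z *m U)))).
apply: eq_card => y; rewrite unfold_in !inE.
apply/andP/eqP => [[_ /eqP <-]|]; first by rewrite split_y.
rewrite mulmxBl => /eqP; rewrite subr_eq0 => /eqP yK.
have phiE : phi y = z.
  have -> : phi y = z *m L *m invmx L by rewrite /phi yK /L !mulmxA.
  by rewrite mulmxK.
by rewrite formE phiE.
Qed.

(** [etaN1] unifies the two residue classes of q modulo 4. *)
Lemma gE m : g #|F| m = if odd m then 0 else (eta (-1 : F) / q) ^+ m./2.
Proof.
rewrite /g etaN1 //; case: ifP => // _; case: (_ == _) => /=.
  by rewrite expr0 !div1r exprVn.
by rewrite expr1 div1r -exprVn invrN mulN1r.
Qed.

(** The main term of the count cancels [q ^+ n], so only the error term at t = 0 remains; it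
    vanishes for odd [m]. *)
Lemma form_zeros m n (K : 'M[F]_n) (U : 'M[F]_(m, n)) :
  K^T = K -> \rank K = m -> U *m K *m U^T \in unitmx ->
  q * (form_count K 0)%:R - q ^+ n
  = (q - 1) * q ^+ n * (g #|F| m * eta (\det (U *m K *m U^T))).
Proof.
move=> symK rkK L1; have q0 := card_field_neq0 F.
have mn : (m <= n)%N by rewrite -rkK rank_leq_row.
rewrite (form_count_singular _ symK rkK L1) natrM natrX form_countE //; last first.
  by rewrite !trmx_mul trmxK symK mulmxA.
have -> : q ^+ n = q ^+ (n - m) * q ^+ m by rewrite -exprD subnK.
rewrite gE /form_error; have [om|em] := boolP (odd m).
  rewrite eta0 !mulr0 !mul0r mulr0 addr0.
  by field.
have -> : q ^+ m = (q ^+ m./2) ^+ 2 by rewrite -exprM muln2 even_halfK.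
rewrite eqxx mulr1 expr_div_n.
by field; rewrite expf_neq0.
Qed.

End FormZeros.

(** * Nowhere-zero flows *)

(** Expansion of the product over [T] of a_i + 1, with a_i = -1 on [Z] and 0 elsewhere: a factor 0
    appears unless [Z] is empty. *)
Lemma sum_sign_subset (T : finType) (Z : {set T}) :
  \sum_(A : {set T} | A \subset Z) (-1) ^+ #|A| = (Z == set0)%:R :> rat.
Proof.
have E : \prod_(i : T) ((if i \in Z then -1 else 0) + 1) = (Z == set0)%:R :> rat.
  have [->|/set0Pn[e eZ]] := eqVneq Z set0.
    by rewrite big1 // => i _; rewrite inE add0r.
  by rewrite (bigD1 e) //= eZ addNr mul0r.
rewrite -E bigA_distr [LHS]big_mkcond /=; apply: eq_bigr => A _.
case: ifP => [/subsetP AZ|/negbT/subsetPn[e eA eZ]]; last first.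
  by rewrite (bigD1 e) //= eA (negPf eZ) mul0r.
rewrite (bigID (mem A)) /= [X in _ * X]big1 ?mulr1 => [|i /negPf -> //].
rewrite -prodr_const; apply: eq_bigr => i iA.
by rewrite iA AZ.
Qed.

Section Flows.
Variables (F : finFieldType) (T : finType) (M : matroid T).
Local Notation E := (ground M).
Local Notation r := (rk M E).
Local Notation q := (#|F|%:R : rat).
Variable v : T -> 'rV[F]_r.
Hypothesis rep : represents M v.

Definition boundary (x : T -> F) : 'rV[F]_r := \sum_e x e *: v e.

(** Functions supported on [S] are row vectors indexed by an enumeration of [S]; those with zero
    boundary form the left kernel of the matrix with rows [v e]. *)
Lemma card_flows (S : {set T}) : S \subset E ->
  #|[set x : {ffun T -> F} | [forall e, (e \notin S) ==> (x e == 0)]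
      && (boundary x == 0)]| = (#|F| ^ (#|S| - rk M S))%N.
Proof.
move=> SE; pose X := rows_of v (fun i : 'I_#|S| => enum_val i).
have imS : (fun i : 'I_#|S| => enum_val i) @: setT = S.
  apply/setP=> e; apply/imsetP/idP => [[i _ ->]|eS]; first exact: enum_valP.
  by exists (enum_rank_in eS e); rewrite ?enum_rankK_in.
have rkX : \rank X = rk M S by rewrite (eqmx_rows_of v) imS (proj1 rep _ SE).
rewrite -rkX -card_kernel.
pose phi (x : {ffun T -> F}) : 'rV[F]_#|S| := \row_i x (enum_val i).
have bE (x : {ffun T -> F}) : (forall e, e \notin S -> x e = 0) -> boundary x = phi x *m X.
  move=> xS; rewrite mulmx_sum_row /boundary (bigID (mem S)) /=.
  rewrite [X in _ + X]big1 => [|e eS]; last by rewrite xS // scale0r.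
  rewrite addr0 (big_enum_val (fun e => x e *: v e)); apply: eq_bigr => i _.
  by rewrite mxE rowK.
(* Inverse of [phi]: outside [S] the index is out of range, which gives the default 0. *)
pose psi (u : 'rV[F]_#|S|) : {ffun T -> F} :=
  [ffun e => if insub (index e (enum S)) is Some i then u 0 i else 0].
have psiS u e : e \notin S -> psi u e = 0.
  by move=> eS; rewrite ffunE insubF // cardE index_mem mem_enum (negPf eS).
have phiK u : phi (psi u) = u.
  apply/rowP=> i; rewrite mxE ffunE.
  have -> : index (enum_val i) (enum S) = i.
    by rewrite /enum_val index_uniq ?enum_uniq // -cardE.
  by rewrite valK.
rewrite -(card_imset _ (can_inj phiK)).
apply: eq_card => x; rewrite inE; apply/andP/imsetP => [[/forallP xS /eqP bx]|].
  have {}xS e : e \notin S -> x e = 0 by move=> eS; have := xS e; rewrite eS => /eqP.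
  exists (phi x); first by rewrite inE -bE // bx.
  apply/ffunP=> e; have [eS|eS] := boolP (e \in S); last by rewrite xS // psiS.
  rewrite ffunE; have lt : (index e (enum S) < #|S|)%N by rewrite cardE index_mem mem_enum.
  rewrite (insubT (fun k => k < #|S|)%N lt) mxE /enum_val /= nth_index ?mem_enum //.
case=> u; rewrite inE => /eqP uX ->; split.
  by apply/forallP=> e; apply/implyP=> /psiS ->.
by rewrite bE ?phiK ?uX // => e; apply: psiS.
Qed.

(** The exponent in the characteristic polynomial of the dual is the nullity of the complement,
    which is the dimension of the space of flows supported there. *)
Lemma dual_rk_sub (A : {set T}) : A \subset E ->
  (rk (dual M) (ground (dual M)) - rk (dual M) A = #|E :\: A| - rk M (E :\: A))%N.
Proof.
move=> AE; rewrite /= /dual_rk setDv.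
have rk0 : rk M set0 = 0%N.
  by have := rk_card (sub0set E); rewrite cards0 leqn0 => /eqP.
have := dual_rk_ge AE; have := rk_card (subxx E); have := subset_leq_card AE.
by rewrite rk0 cardsD (setIidPr AE); lia.
Qed.

(** Inclusion-exclusion over the sets [A] on which the flow is required to vanish. *)
Lemma card_nowhere_zero_flows :
  #|[set x in nzfun F E | boundary x == 0]|%:R = (charpoly (dual M)).[q].
Proof.
have -> : (charpoly (dual M)).[q] = \sum_(A : {set T} | A \subset E) (-1) ^+ #|A| *
    #|[set x : {ffun T -> F} | [forall e, (e \notin E :\: A) ==> (x e == 0)]
      && (boundary x == 0)]|%:R.
  rewrite /charpoly horner_sum; apply: eq_bigr => A AE.
  by rewrite card_flows ?subsetDl // hornerZ hornerXn -dual_rk_sub // natrX.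
pose P (x : {ffun T -> F}) (A : {set T}) := [forall e, (e \notin E :\: A) ==> (x e == 0)].
transitivity (\sum_(A : {set T} | A \subset E)
   \sum_(x : {ffun T -> F} | boundary x == 0) (-1) ^+ #|A| * (P x A)%:R : rat); last first.
  apply: eq_bigr => A AE; rewrite -mulr_sumr; congr (_ * _).
  rewrite -sum1_card natr_sum [RHS]big_mkcond [LHS]big_mkcond; apply: eq_bigr => x _.
  by rewrite inE -/(P x A); case: (P x A); case: ifP.
rewrite exchange_big /= -sum1_card natr_sum [LHS]big_mkcond [RHS]big_mkcond.
apply: eq_bigr => x _; rewrite inE; case: eqP => _; rewrite ?andbF // andbT.
(* If [x] vanishes outside [E], the sets [A] that count it are the subsets of [Z], so the
   alternating sum is 1 if [Z] is empty and 0 otherwise. *)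
pose Z := [set e in E | x e == 0].
transitivity (if [forall e, (e \notin E) ==> (x e == 0)] then (Z == set0)%:R else 0 : rat).
  case: ifP => [/nzfunP xE|nx].
    rewrite ifT; last first.
      by apply/forallP=> e; apply/implyP=> eE; rewrite -[_ == _]negbK xE.
    suff -> : Z = set0 by rewrite eqxx.
    by apply/setP=> e; rewrite !inE -xE; case: eqP.
  case: ifP => // /forallP xE; have [Z0|//] := eqVneq Z set0.
  case/negP: (negbT nx); apply/nzfunP=> e.
  have := xE e; have /setP/(_ e) := Z0; rewrite !inE.
  by case: (e \in E) => /= [->|_ ->].
rewrite -sum_sign_subset; case: ifP => [/forallP xE|/negbT/forallPn[e]].
  rewrite big_mkcond [RHS]big_mkcond; apply: eq_bigr => A _.
  have -> : (A \subset Z) = (A \subset E) && P x A.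
    apply/subsetP/andP => [AZ|[/subsetP AE /forallP xA] e eA].
      split; first by apply/subsetP=> e /AZ; rewrite inE => /andP[].
      apply/forallP=> e; apply/implyP; rewrite inE negb_and negbK => /orP[/AZ|eE].
        by rewrite inE => /andP[].
      by have := xE e; rewrite eE.
    by rewrite inE AE //=; have := xA e; rewrite inE eA.
  by case: (A \subset E); case: (P x A); rewrite ?mulr1 ?mulr0.
rewrite negb_imply => /andP[eE xe]; rewrite big1 // => A AE.
rewrite (_ : P x A = false) ?mulr0 //; apply/negbTE/forallPn; exists e.
by rewrite inE (negPf eE) andbF.
Qed.

Lemma gram_form (alpha : T -> F) (y : 'rV[F]_r) :
  (y *m gram v alpha *m y^T) 0 0 = \sum_e alpha e * ((v e *m y^T) 0 0) ^+ 2.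
Proof.
rewrite /gram mulmx_sumr mulmx_suml summxE; apply: eq_bigr => e _.
rewrite -scalemxAr -scalemxAl mxE; congr (_ * _).
have -> : y *m ((v e)^T *m v e) *m y^T = (v e *m y^T)^T *m (v e *m y^T).
  by rewrite trmx_mul trmxK !mulmxA.
by rewrite [LHS]mxE big_ord1 [_^T _ _]mxE expr2.
Qed.

(* For fixed y, rescaling alpha e by the pairing of y with v e makes the
   quadratic form linear. *)
Lemma sum_form_count :
  (\sum_(alpha in nzfun F E) form_count (gram v alpha) 0%R)%N =
  (\sum_(x in nzfun F E) #|[set y : 'rV[F]_r | (y *m (boundary x)^T == 0)%R]|)%N.
Proof.
pose b (y : 'rV[F]_r) e : F := (v e *m y^T) 0 0.
transitivity (\sum_(y : 'rV[F]_r) \sum_(alpha in nzfun F E)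
    ((\sum_e alpha e * b y e ^+ 2 == 0)%R : nat))%N.
  rewrite exchange_big; apply: eq_bigr => alpha _.
  rewrite /form_count -sum1_card [LHS]big_mkcond; apply: eq_bigr => y _.
  by rewrite inE gram_form.
transitivity (\sum_(y : 'rV[F]_r) \sum_(x in nzfun F E)
    ((\sum_e x e * b y e == 0)%R : nat))%N; last first.
  rewrite exchange_big; apply: eq_bigr => x _.
  rewrite -sum1_card [RHS]big_mkcond; apply: eq_bigr => y _.
  rewrite inE; have -> : (y *m (boundary x)^T == 0) = (\sum_e x e * b y e == 0).
    have -> : y *m (boundary x)^T = (\sum_e x e * b y e)%:M.
      apply: trmx_inj; rewrite trmx_mul trmxK tr_scalar_mx [LHS]mx11_scalar.
      congr (_%:M); rewrite /boundary mulmx_suml summxE; apply: eq_bigr => e _.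
      by rewrite -scalemxAl mxE.
    by rewrite -scalemx1 scalemx_eq0 oner_eq0 orbF.
  by [].
apply: eq_bigr => y _.
(* The default 1 keeps the substitution invertible on nowhere-zero functions; where [b y e] is 0,
   both sums have the term 0 anyway. *)
pose c e := if b y e == 0 then 1 else b y e.
have c0 e : c e != 0 by rewrite /c; case: ifP; rewrite ?oner_eq0 // => ->.
rewrite [RHS](reindex_onto (fun alpha : {ffun T -> F} => [ffun e => alpha e * c e])
  (fun x : {ffun T -> F} => [ffun e => x e / c e])) /=; last first.
  by move=> x _; apply/ffunP=> e; rewrite !ffunE divfK.
apply: eq_big => [alpha|alpha _].
  rewrite [X in _ && X](_ : _ = true) ?andbT; last first.
    by apply/eqP/ffunP=> e; rewrite !ffunE mulfK.
  apply/nzfunP/nzfunP => aE e; rewrite -aE ffunE mulf_eq0 negb_or c0 andbT //.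
congr (nat_of_bool (_ == _)); apply: eq_bigr => e _; rewrite ffunE -mulrA; congr (_ * _).
by rewrite /c expr2; case: ifP => // /eqP ->; rewrite !mulr0.
Qed.

(** For each [x] there are q^(r-1) vectors orthogonal to its boundary, which contributes 0, unless
    the boundary is 0 and there are q^r of them. *)
Lemma sum_form_zeros : \sum_(alpha in nzfun F E)
    (q * (form_count (gram v alpha) 0)%:R - q ^+ r)
  = (q - 1) * q ^+ r * (charpoly (dual M)).[q].
Proof.
rewrite sumrB -mulr_sumr -natr_sum sum_form_count natr_sum mulr_sumr -sumrB.
rewrite -card_nowhere_zero_flows -sum1_card natr_sum mulr_sumr.
rewrite [LHS]big_mkcond [RHS]big_mkcond; apply: eq_bigr => x _.
rewrite inE; case: (x \in _) => //=; rewrite card_kernel mxrank_tr natrX mulr1.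
have [->|b0] := eqVneq (boundary x) 0.
  by rewrite mxrank0 subn0; ring.
have -> : \rank (boundary x) = 1%N.
  by apply/eqP; rewrite eqn_leq rank_leq_row lt0n mxrank_eq0.
have r0 : (0 < r)%N.
  by apply: leq_trans (rank_leq_col (boundary x)); rewrite lt0n mxrank_eq0.
by rewrite -exprS subn1 prednK // subrr.
Qed.

End Flows.

(** * Comparison of the two counts *)

Lemma Aperp_term (F : finFieldType) (T : finType) (M : matroid T)
    (v : T -> 'rV[F]_(rk M (ground M))) (alpha : T -> F) (A : {set T}) :
  odd #|F| -> represents M v ->
  (forall h, frame v h -> \det (rows_of v h) ^+ 2 = 1) -> is_Aperp M alpha A ->
  #|F|%:R * (form_count (gram v alpha) 0)%:R - #|F|%:R ^+ rk M (ground M)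
  = (#|F|%:R - 1) * #|F|%:R ^+ rk M (ground M) *
    (g #|F| (total_rk (contraction M A)) * eta (basis_sum (contraction M A) alpha)).
Proof.
move=> odd_card rep uni isA.
have [m [U [<- rkK [delta d0 dE]]]] := Aperp_gram rep uni isA.
have s0 : basis_sum (contraction M A) alpha != 0 by case: isA.
have L1 : U *m gram v alpha *m U^T \in unitmx.
  by rewrite unitmxE dE unitfE mulf_neq0 // sqrf_eq0.
rewrite (form_zeros odd_card (gram_sym v alpha) rkK L1) dE.
by rewrite eta_mul // eta_sqr // mul1r.
Qed.

Theorem theorem3 (p d q : nat) (p_prime : prime p) (p_odd : odd p)
    (d_gt0 : (0 < d)%N) (q_def : q = (p ^ d)%N)
    (F : finFieldType) (cardF : #|F| = q)
    (T : finType) (M : matroid T)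
    (M_regular : regular M)
    (M_coloopless : forall e : T, ~ coloop M e) :
  (forall Aperp : {ffun T -> F} -> {set T},
     (forall alpha, alpha \in nzfun F (ground M) ->
        is_Aperp M alpha (Aperp alpha)) ->
     (charpoly (dual M)).[q%:R] =
       \sum_(alpha in nzfun F (ground M))
          g q (total_rk (contraction M (Aperp alpha)))
          * eta (basis_sum (contraction M (Aperp alpha)) alpha))
  /\
  (forall alpha, alpha \in nzfun F (ground M) ->
     forall A B : {set T}, is_Aperp M alpha A -> is_Aperp M alpha B ->
       g q (total_rk (contraction M A))
         * eta (basis_sum (contraction M A) alpha)
       = g q (total_rk (contraction M B))
         * eta (basis_sum (contraction M B) alpha)).
Proof.
have odd_card : odd #|F| by rewrite cardF q_def oddX p_odd orbT.
have [v rep uni] := regular_unimodular F M_regular.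
have nz : (#|F|%:R - 1) * #|F|%:R ^+ rk M (ground M) != 0 :> rat.
  rewrite mulf_neq0 ?expf_neq0 ?card_field_neq0 // subr_eq0.
  by rewrite Num.Theory.pnatr_eq1 neq_ltn finNzRing_gt1 orbT.
(* Multiplied by (q - 1) q^r, each term becomes q N - q^r, with N the number of zeros of its
   form. *)
rewrite -cardF; split=> [Aperp isA|alpha _ A B isA isB]; apply: (mulfI nz).
  rewrite -(sum_form_zeros rep) mulr_sumr; apply: eq_bigr => alpha aE.
  by apply: Aperp_term => //; apply: isA.
(* The left side of [Aperp_term] does not involve the chosen set. *)
by rewrite -!(Aperp_term odd_card rep uni).
Qed.
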